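(* Let $\alpha>0$ and $\delta>0$ be fixed real numbers. (1) If $\alpha+\delta>\tfrac12$, then $$\lim_{n\to\infty}\frac{\log\mathcal{R}_n(A^\ast(\delta,\alpha;n))}{\log|\mathcal{S}|}=-\frac{\delta^2}{4(1+\delta)} .$$ Moreover, for all $\alpha>0$ and $\delta>0$ (without assuming $\alpha+\delta>\tfrac12$), the same conclusion holds when the signal strength is $A=\sqrt{4(1+\delta)\alpha\log n/n}$, that is, $$\lim_{n\to\infty}\frac{\log\mathcal{R}_n\big(\sqrt{4(1+\delta)\alpha\log n/n}\,\big)}{\log|\mathcal{S}|}=-\frac{\delta^2}{4(1+\delta)} .$$ (2) If $\alpha+\delta>\tfrac12$ and also $\alpha\le\tfrac12$, then $$\lim_{n\to\infty}\frac{\log\mathcal{R}_n(A^\ast_{\mathrm{BI}}(\delta,\alpha;n))}{n^{2(\alpha+\delta)}}=-\frac18 .$$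
   Context: For positive integers $n\le N$ and a real number $A\ge 0$, let $\Theta(A,n,N)$ be the set of matrices $\boldsymbol{\theta}=(\theta_{ij})\in\mathbb{R}^{N\times N}$ for which there exist $R,C\subset\{1,\dots,N\}$ with $|R|=|C|=n$ such that $\theta_{ij}\ge A$ for all $(i,j)\in R\times C$ and $\theta_{ij}=0$ for all other $(i,j)$. For $\boldsymbol{\theta}\in\mathbb{R}^{N\times N}$ let $\mathbb{P}_{\boldsymbol{\theta}}$ denote the law of a random matrix $\mathbf{X}=(X_{ij})_{1\le i,j\le N}$ with independent entries $X_{ij}\sim N(\theta_{ij},1)$, and let $\mathbb{P}_0$ be this law for $\boldsymbol{\theta}=\mathbf{0}$. A test is a measurable function $T=T(\mathbf{X})$ with values in $\{0,1\}$. The minimax risk is $$\mathcal{R}_{n,N}(A)=\inf_{T}\Big\{\mathbb{P}_0(T=1)+\sup_{\boldsymbol{\theta}\in\Theta(A,n,N)}\mathbb{P}_{\boldsymbol{\theta}}(T=0)\Big\},$$ the infimum being over all tests. For fixed $\alpha>0$ put $N=\lfloor n^{1+\alpha}\rfloor$ and $\mathcal{R}_n(A)=\mathcal{R}_{n,\lfloor n^{1+\alpha}\rfloor}(A)$. Let $$\mathcal{S}=\{R\times C\subset\{1,\dots,N\}^2:\ |R|=|C|=n\},$$ so $|\mathcal{S}|=\binom{N}{n}^2$. For $\delta\in(-1,\infty)$ define $$A^\ast(\delta,\alpha;n)=\min\Big\{n^{-(1-\alpha-\delta)},\ \sqrt{\tfrac{4(1+\delta)\alpha\log n}{n}}\Big\},$$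 and $$A^\ast_{\mathrm{BI}}(\delta,\alpha;n)=\begin{cases} n^{-(1-\alpha-\delta)}, & \alpha\le \tfrac12,\\ \sqrt{\tfrac{4(1+\delta)\alpha\log n}{n}}, & \alpha>\tfrac12.\end{cases}$$ *)

(* Defs.v *)
From HB Require Import structures.
From mathcomp Require Import all_boot all_order all_algebra.
From mathcomp Require Import all_classical all_reals all_analysis.

Set Implicit Arguments.
Unset Strict Implicit.
Unset Printing Implicit Defensive.

Import Order.TTheory GRing.Theory Num.Theory.
Import numFieldNormedType.Exports.

Local Open Scope classical_set_scope.
Local Open Scope ring_scope.

(* The law of a tuple with independent entries of (possibly different) laws
   P 0, ..., P (n - 1). *)
Section tuple_law.
Context d (T : measurableType d) (R : realType).

Definition tuple_cons n (x : T * n.-tuple T) : n.+1.-tuple T :=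
  [tuple of x.1 :: x.2].

Lemma measurable_tuple_cons n : measurable_fun setT (@tuple_cons n).
Proof. exact: measurable_cons. Qed.

HB.instance Definition _ n :=
  isMeasurableFun.Build _ _ _ _ (@tuple_cons n) (@measurable_tuple_cons n).

Fixpoint tuple_law n : ('I_n -> probability T R) -> probability (n.-tuple T) R :=
  match n with
  | 0 => fun=> \d_ [tuple]
  | n'.+1 => fun P =>
      distribution (P ord0 \x tuple_law (fun i => P (lift ord0 i)))%E
                   (@tuple_cons n')
  end.

Lemma measurable_tuple_box n (A : 'I_n -> set T) :
  (forall i, measurable (A i)) ->
  measurable [set t : n.-tuple T | forall i, A i (tnth t i)].
Proof.
move=> mA.
have -> : [set t : n.-tuple T | forall i, A i (tnth t i)] =
    \bigcap_(i in [set: 'I_n]) ((fun t : n.-tuple T => tnth t i) @^-1` A i).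
  by apply/seteqP; split=> t /= tA i; [move=> _|]; exact: tA.
apply: fin_bigcap_measurable => // i _.
by rewrite -[X in measurable X]setTI; exact: measurable_tnth.
Qed.

Lemma tuple_law_box n (P : 'I_n -> probability T R) (A : 'I_n -> set T) :
  (forall i, measurable (A i)) ->
  tuple_law P [set t | forall i, A i (tnth t i)] = (\prod_(i < n) P i (A i))%E.
Proof.
elim: n P A => [|n IHn] P A mA.
  rewrite big_ord0 /= diracE mem_set//=.
  by case.
rewrite big_ord_recl -(IHn (fun i => P (lift ord0 i)) (fun i => A (lift ord0 i)))//.
rewrite -product_measure1E//; last first.
  by apply: (@measurable_tuple_box n (fun i => A (lift ord0 i))) => i.
rewrite /= /distribution /pushforward; congr ((_ \x _)%E _).
apply/seteqP; split => -[x t] /= At.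
  split=> [|i]; first exact: (At ord0).
  by have := At (lift ord0 i); rewrite tnthS.
move=> i; have [j ->|->] := unliftP ord0 i; last by case: At.
by rewrite tnthS; case: At.
Qed.

End tuple_law.

(* The Borel sigma-algebra of the matrices, generated by the entries. *)
Section measurable_matrix.
Context (R : realType) (m n : nat).

Definition matrix_cylinders : set (set 'M[R]_(m, n)) :=
  [set C | exists i j, exists2 B : set (measurableTypeR R),
     measurable B & C = [set X : 'M[R]_(m, n) | B (X i j)]].

HB.instance Definition _ := @isMeasurable.Build (sigma_display matrix_cylinders)
  'M[R]_(m, n) <<s matrix_cylinders >>
  (@sigma_algebra0 _ setT matrix_cylinders) (@sigma_algebraC _ matrix_cylinders)
  (@sigma_algebra_bigcup _ setT matrix_cylinders).

Definition matrix_of_tuple (t : (m * n).-tuple (measurableTypeR R)) :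
  'M[R]_(m, n) := \matrix_(i, j) tnth t (mxvec_index i j).

Lemma measurable_matrix_of_tuple : measurable_fun setT matrix_of_tuple.
Proof.
apply: (@measurability _ _ _ _ _ _ matrix_cylinders) => //.
move=> _ [_ [i [j [B mB ->]]] <-].
rewrite setTI (_ : _ @^-1` _ =
    (fun t : (m * n).-tuple (measurableTypeR R) => tnth t (mxvec_index i j)) @^-1` B).
  by rewrite -[X in measurable X]setTI; exact: measurable_tnth.
by apply/funext => t; rewrite /preimage/= mxE.
Qed.

HB.instance Definition _ := isMeasurableFun.Build _ _ _ _
  matrix_of_tuple measurable_matrix_of_tuple.

End measurable_matrix.

Section gaussian_matrix.
Context (R : realType).

(* [normal_prob m s] is parametrized by the standard deviation [s]. *)
Definition entry_law m n (theta : 'M[R]_(m, n)) (k : 'I_(m * n)) :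
  probability (measurableTypeR R) R := normal_prob (mxvec theta ord0 k) 1.

Definition gaussian_law m n (theta : 'M[R]_(m, n)) : probability 'M[R]_(m, n) R :=
  distribution (tuple_law (entry_law theta)) (@matrix_of_tuple R m n).

Lemma gaussian_law_box m n (theta : 'M[R]_(m, n))
    (B : 'I_m -> 'I_n -> set (measurableTypeR R)) :
  (forall i j, measurable (B i j)) ->
  gaussian_law theta [set X | forall i j, B i j (X i j)] =
    (\prod_(i < m) \prod_(j < n) normal_prob (theta i j) 1 (B i j))%E.
Proof.
move=> mB.
have mxvecP (k : 'I_(m * n)) : exists ij : 'I_m * 'I_n, k = mxvec_index ij.1 ij.2.
  by case/mxvec_indexP: k => i j; exists (i, j).
pose A (k : 'I_(m * n)) := let ij := projT1 (cid (mxvecP k)) in B ij.1 ij.2.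
have AE i j : A (mxvec_index i j) = B i j.
  rewrite /A; case: cid => -[i' j'] /= /(can_inj (@cast_ordK _ _ _)).
  by move=> /enum_rank_inj[-> ->].
have mA k : measurable (A k) by exact: mB.
rewrite pair_big/= -[RHS]/(\prod_(p : 'I_m * 'I_n) _)%E.
transitivity (\prod_(k < m * n) entry_law theta k (A k))%E; last first.
  rewrite (reindex _ (curry_mxvec_bij m n))/=.
  by apply: eq_bigr => -[i j] _ /=; rewrite AE /entry_law mxvecE.
rewrite -tuple_law_box//; congr (tuple_law _ _).
apply/seteqP; split=> t /= tB.
  by case/mxvec_indexP => i j; rewrite AE; have := tB i j; rewrite mxE.
by move=> i j; rewrite mxE -AE; exact: tB.
Qed.

Definition Theta (A : R) (n N : nat) : set 'M[R]_N :=
  [set theta : 'M[R]_N | exists Rw Cl : {set 'I_N},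
     [/\ #|Rw| = n, #|Cl| = n,
         forall i j, (i, j) \in finset.setX Rw Cl -> A <= theta i j
       & forall i j, (i, j) \notin finset.setX Rw Cl -> theta i j = 0]].

Arguments Theta : clear implicits.

(* Tests are boolean-valued, [true] standing for 1 (rejection). *)
Definition minimax_risk (n N : nat) (A : R) : \bar R :=
  ereal_inf [set (gaussian_law (0 : 'M[R]_N) (T @^-1` [set true]) +
                  ereal_sup [set gaussian_law theta (T @^-1` [set false])
                            | theta in Theta A n N])%E
            | T in [set: {mfun 'M[R]_N >-> bool}]].

Definition matrix_size (alpha : R) (n : nat) : nat := Num.truncn (n%:R `^ (1 + alpha)).

(* The risk lies in ]0, 1] when 0 < n, so [fine] loses nothing. *)
Definition risk (alpha : R) (n : nat) (A : R) : R :=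
  fine (minimax_risk n (matrix_size alpha n) A).

Definition scan_sets (n N : nat) : {set {set 'I_N * 'I_N}} :=
  [set finset.setX Rw Cl | Rw in [set Rw : {set 'I_N} | #|Rw| == n],
                           Cl in [set Cl : {set 'I_N} | #|Cl| == n]]%SET.

Lemma card_scan_sets (n N : nat) : (0 < n)%N ->
  #|scan_sets n N| = ('C(N, n) ^ 2)%N.
Proof.
move=> n_gt0; rewrite /scan_sets curry_imset2X card_in_imset; last first.
  have cardP (S : {set 'I_N}) : #|S| == n -> exists x, x \in S.
    by move=> /eqP Sn; apply/set0Pn; rewrite -card_gt0 Sn.
  move=> [S1 S2] [S3 S4]; rewrite !finset.in_setX !finset.inE /=.
  move=> /andP[c1 c2] /andP[c3 c4] /setP e.
  have [[x1 m1] [x2 m2]] := (cardP _ c1, cardP _ c2).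
  have [] : x1 \in S3 /\ x2 \in S4.
    by apply/andP; have := e (x1, x2); rewrite !finset.in_setX m1 m2 /= => <-.
  move=> m3 m4; congr pair; apply/setP => x.
    by have := e (x, x2); rewrite !finset.in_setX m2 m4 !andbT.
  by have := e (x1, x); rewrite !finset.in_setX m1 m3.
by rewrite cardsX -mulnn !card_draws card_ord.
Qed.

Definition Ascan (delta alpha : R) (n : nat) : R :=
  Num.sqrt (4 * (1 + delta) * alpha * ln n%:R / n%:R).

Definition Astar (delta alpha : R) (n : nat) : R :=
  Num.min (n%:R `^ (- (1 - alpha - delta))) (Ascan delta alpha n).

Definition AstarBI (delta alpha : R) (n : nat) : R :=
  if alpha <= 1 / 2 then n%:R `^ (- (1 - alpha - delta))
  else Ascan delta alpha n.

End gaussian_matrix.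

Arguments Theta {R} A n N _ : rename.

(* Main.v *)
Require Import Defs.
From HB Require Import structures.
From mathcomp Require Import all_boot all_order all_algebra.
From mathcomp Require Import all_classical all_reals all_analysis.
From mathcomp Require Import measurable_realfun ring lra.

(** Write d = n A for the strength of the signal along its own square,
    M = C(N, n) and L = 2 ln M, the logarithm of the number of squares.  All
    three limits come from one bound, valid for 0 < n <= N as soon as
    L <= d^2 / 2: up to an additive error of order sqrt(n) d + n, the logarithm
    of the minimax risk is - (d^2 / 2 - L)^2 / (2 d^2)  ([log_risk_bounds]).

    Upper bound ([scan_test_risk]).  Reject when some n x n square has sum at
    least n t.  The union bound gives a false alarm of exp (L - t^2 / 2), and a
    missed signal costs exp (- (d - t)^2 / 2).  The two exponents agree at
    t = (L + d^2 / 2) / d, where both are the announced one.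

    Lower bound ([minimax_risk_lower]).  Plant, in a uniformly chosen square,
    the intermediate mean B = t / n instead of A.  Under this law every test
    either accepts or rejects with probability at least 1/2.
    - If it accepts, moving the mean of the square from B to A turns this into
      a missed signal, at the price exp (- (d - t)^2 / 2) ([accept_cost]).
    - If it rejects, one compares the mixture over all squares with the null
      law; the likelihood ratio has to be at most exp ((d - t)^2 / 2) up to the
      error term, with large probability ([LR_dev], [reject_cost]).  Its plain
      first moment is much larger, being carried by rare noise inside the
      planted square.  So one first imposes that no subrectangle of the planted
      square exceeds its mean by 4 n^(3/2): there are only 4^n of them, so this
      fails with small probability ([wild_dev]).  A competing square sharing k
      rows and l columns with the planted one then contributes about
      exp (B^2 k l / 2), and a fraction of about M^(- (k + l) / n) of all squares
      has this overlap, up to exp (O(n)) ([sum_overlap_le]).  With x = k / n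
      and y = l / n, what remains is t^2 x y / 2 - L (x + y) / 2 <= t^2 / 2 - L,
      true because L <= t^2 / 2 and x y <= (x + y) / 2 on the unit square; and
      t^2 / 2 - L = (d - t)^2 / 2.

    Asymptotics.  Since ln M = alpha n ln n + O(n), at the scan level
    d^2 / 2 ~ (1 + delta) L, and the error term is o(L); dividing by L gives
    delta^2 / (4 (1 + delta)).  At the level n^(- (1 - alpha - delta)) one has
    d^2 = n^(2 (alpha + delta)), and L = o(d^2) when alpha + delta > 1/2, whence
    1/8; in the same range the scan level is eventually the smaller one. *)

Set Implicit Arguments.
Unset Strict Implicit.
Unset Printing Implicit Defensive.

Import Order.TTheory GRing.Theory Num.Theory.
Import numFieldNormedType.Exports.

Local Open Scope classical_set_scope.
Local Open Scope ring_scope.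

(** * Product laws and densities *)

Section density.
Context d (T : measurableType d) (R : realType).
Variables (mu nu : {measure set T -> \bar R}) (f : T -> R).
Hypotheses (mf : measurable_fun setT f) (f0 : forall x, 0 <= f x).
Hypothesis nuE : forall A, measurable A -> nu A = (\int[mu]_(x in A) (f x)%:E)%E.
Local Open Scope ereal_scope.

Import HBNNSimple.

Let density_nnsfun (h : {nnsfun T >-> R}) :
  \int[nu]_x (h x)%:E = \int[mu]_x ((h x)%:E * (f x)%:E).
Proof.
under [LHS]eq_integral do rewrite fimfunE -fsumEFin//.
rewrite [LHS]ge0_integral_fsum//; last 2 first.
  - by move=> r; exact/measurable_EFinP/measurableT_comp.
  - by move=> n x _; rewrite EFinM nnfun_muleindic_ge0.
under [RHS]eq_integral.
  move=> x xD; rewrite fimfunE -fsumEFin// muleC ge0_mule_fsumr; last first.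
    by move=> r; rewrite EFinM nnfun_muleindic_ge0.
  over.
rewrite [RHS]ge0_integral_fsum//; last 2 first.
  - move=> r; apply: emeasurable_funM; first exact/measurable_EFinP.
    by apply/measurable_EFinP; apply/measurableT_comp.
  - move=> n x _; rewrite mule_ge0 ?lee_fin//.
    by rewrite -lee_fin EFinM nnfun_muleindic_ge0.
apply: eq_fsbigr => r _.
have [->|r0] := eqVneq (\1_(h @^-1` [set r]) : T -> R) (cst 0%R).
  by rewrite !integral0_eq// => x _ /=; rewrite mulr0// mule0.
have {}r0 : (0 <= r)%R.
  rewrite leNgt; apply/negP => rlt0; move/eqP : r0; apply.
  by rewrite preimage_nnfun0// indic0.
rewrite integralZl_indic_nnsfun//= integral_indic// setIT nuE//.
under [RHS]eq_integral do rewrite muleC EFinM -muleA.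
rewrite ge0_integralZl//; last 2 first.
- by apply: emeasurable_funM; apply/measurable_EFinP => //; exact: measurable_indic.
- by move=> x _; rewrite -EFinM lee_fin mulr_ge0// indicE ler0n.
congr (_ * _); rewrite integral_mkcond; apply: eq_integral => x _.
rewrite patchE -EFinM indicE; case: ifP => _; first by rewrite mul1r.
by rewrite mul0r.
Qed.

(** The defining identity of a density, extended from sets to nonnegative
    functions by monotone convergence along simple functions. *)
Lemma ge0_integral_density (g : T -> \bar R) :
  measurable_fun setT g -> (forall x, 0 <= g x) ->
  \int[nu]_x g x = \int[mu]_x (g x * (f x)%:E).
Proof.
move=> mg g0; pose g_ := nnsfun_approx measurableT mg.
transitivity (limn (fun n => \int[nu]_x (g_ n x)%:E)).
  rewrite -monotone_convergence//=.
  - by apply: eq_integral => x _; apply/esym/cvg_lim => //=; exact: cvg_nnsfun_approx.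
  - by move=> n; exact/measurable_EFinP.
  - by move=> n x _; rewrite lee_fin.
  - by move=> x _ a b ab; rewrite lee_fin//; exact/lefP/nd_nnsfun_approx.
rewrite (_ : \int[mu]_x _ = limn (fun n => \int[mu]_x ((g_ n x)%:E * (f x)%:E))).
  by congr (limn _); apply/funext => n; exact: density_nnsfun.
rewrite -monotone_convergence//=.
- apply: eq_integral => x _; apply/esym/cvg_lim => //=.
  by apply: cvgeZr => //; exact: cvg_nnsfun_approx.
- by move=> n; apply: emeasurable_funM; exact/measurable_EFinP.
- by move=> n x _; rewrite -EFinM lee_fin mulr_ge0.
- move=> x _ a b ab; rewrite -!EFinM lee_fin ler_wpM2r//.
  exact/lefP/nd_nnsfun_approx.
Qed.

End density.

Section tuple_density.
Context d (T : measurableType d) (R : realType).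
Local Open Scope ereal_scope.

Lemma integral_tuple_law_cons n (P : 'I_n.+1 -> probability T R)
    (g : n.+1.-tuple T -> \bar R) :
  measurable_fun setT g -> (forall t, 0 <= g t) ->
  \int[tuple_law P]_t g t =
  \int[P ord0]_x \int[tuple_law (fun i => P (lift ord0 i))]_t
    g (tuple_cons (x, t)).
Proof.
move=> mg g0; rewrite /= ge0_integral_distribution//.
rewrite fubini_tonelli1//; last by move=> x; exact: g0.
by apply: measurableT_comp => //; exact: measurable_tuple_cons.
Qed.

Lemma measurable_prod_tnth n (f : 'I_n -> T -> R) :
  (forall i, measurable_fun setT (f i)) ->
  measurable_fun setT (fun t : n.-tuple T => \prod_(i < n) f i (tnth t i))%R.
Proof.
move=> mf; apply: measurable_prod => i _.
by apply: measurableT_comp => //; exact: measurable_tnth.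
Qed.

(** The product of the densities of the factors is a density of the product
    law: peel off one coordinate with Tonelli and use the induction hypothesis
    on the inner integral. *)
Lemma integral_tuple_law_density n (P P' : 'I_n -> probability T R)
    (f : 'I_n -> T -> R) :
  (forall i, measurable_fun setT (f i)) -> (forall i x, (0 <= f i x)%R) ->
  (forall i (g : T -> \bar R), measurable_fun setT g -> (forall x, 0 <= g x) ->
     \int[P' i]_x g x = \int[P i]_x (g x * (f i x)%:E)) ->
  forall g : n.-tuple T -> \bar R,
  measurable_fun setT g -> (forall t, 0 <= g t) ->
  \int[tuple_law P']_t g t =
  \int[tuple_law P]_t (g t * (\prod_(i < n) f i (tnth t i))%:E).
Proof.
elim: n P P' f => [|n IHn] P P' f mf f0 PP' g mg g0.
  by apply: eq_integral => t _; rewrite big_ord0 mule1.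
have mcons : measurable_fun setT (fun z : T * n.-tuple T => g (tuple_cons z)).
  by apply: measurableT_comp => //; exact: measurable_tuple_cons.
pose f' i := f (lift ord0 i).
pose Q i := P (lift ord0 i).
have mp : measurable_fun setT (fun z : T * n.-tuple T =>
    g (tuple_cons z) * (\prod_(i < n) f' i (tnth z.2 i))%:E).
  apply: emeasurable_funM => //; apply/measurable_EFinP.
  apply: (measurableT_comp (f := fun t : n.-tuple T =>
    (\prod_(i < n) f' i (tnth t i))%R)) => //.
  by apply: measurable_prod_tnth => i; exact: mf.
have p0 z : 0 <= g (tuple_cons z) * (\prod_(i < n) f' i (tnth z.2 i))%:E.
  rewrite mule_ge0// lee_fin; apply: prodr_ge0 => i _; exact: f0.
rewrite integral_tuple_law_cons// [RHS]integral_tuple_law_cons//; last 2 first.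
- apply: emeasurable_funM => //; apply/measurable_EFinP.
  exact: measurable_prod_tnth.
- move=> t; rewrite mule_ge0// lee_fin; apply: prodr_ge0 => i _; exact: f0.
transitivity (\int[P' ord0]_x \int[tuple_law Q]_t
   (g (tuple_cons (x, t)) * (\prod_(i < n) f' i (tnth t i))%:E)).
  apply: eq_integral => x _; apply: (IHn _ _ f') => //.
  - by move=> i; exact: mf.
  - by move=> i y; exact: f0.
  - by move=> i h mh h0; rewrite PP'.
  - exact: (measurableT_comp mcons).
rewrite PP'//; last 2 first.
- exact: (measurable_fun_fubini_tonelli_F (m2 := tuple_law Q) _ mp p0).
- by move=> x; apply: integral_ge0 => t _; exact: (p0 (x, t)).
apply: eq_integral => x _; rewrite -ge0_integralZr//; last 2 first.
- exact: (measurableT_comp mp (pair1_measurable x)).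
- by rewrite lee_fin.
apply: eq_integral => t _; rewrite -muleA; congr (_ * _).
rewrite -EFinM big_ord_recl mulrC; congr ((_ * _)%R%:E).
by apply: eq_bigr => i _; rewrite tnthS.
Qed.

End tuple_density.

(** * Gaussian matrices: change of mean, exponential bounds *)

Section gaussian_shift.
Context (R : realType).

Definition likelihood_ratio (a b x : R) : R := expR ((b - a) * x - (b ^+ 2 - a ^+ 2) / 2).

Lemma normal_pdf_shift (a b x : R) :
  normal_pdf b 1 x = normal_pdf a 1 x * likelihood_ratio a b x.
Proof.
rewrite !normal_pdfE ?oner_neq0// -mulrA; congr (_ * _).
rewrite /normal_fun /likelihood_ratio -expRD; congr expR.
by rewrite expr1n; field.
Qed.

Lemma measurable_likelihood_ratio (a b : R) : measurable_fun setT (likelihood_ratio a b).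
Proof.
apply: measurableT_comp => //; apply: measurable_funB => //.
Qed.

Lemma integral_normal_prob_shift (a b : R) (g : measurableTypeR R -> \bar R) :
  measurable_fun setT g -> (forall x, 0 <= g x)%E ->
  (\int[normal_prob b 1]_x g x =
   \int[normal_prob a 1]_x (g x * (likelihood_ratio a b x)%:E))%E.
Proof.
move=> mg g0.
have mL := measurable_likelihood_ratio a b.
have dens c (h : measurableTypeR R -> \bar R) : measurable_fun setT h ->
    (forall x, 0 <= h x)%E ->
    (\int[normal_prob c 1]_x h x =
     \int[lebesgue_measure]_x (h x * (normal_pdf c 1 x)%:E))%E.
  move=> mh h0; apply: ge0_integral_density => //.
  - exact: measurable_normal_pdf.
  - exact: normal_pdf_ge0.
rewrite !dens//.
- by apply: eq_integral => x _; rewrite (normal_pdf_shift a) mulrC EFinM muleA.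
- by apply: emeasurable_funM => //; exact/measurable_EFinP.
- by move=> x; rewrite mule_ge0// lee_fin expR_ge0.
Qed.

End gaussian_shift.

Section dot_product.
Context (R : realType) (m n : nat).
Implicit Types c X Y : 'M[R]_(m, n).

Definition mxdot c X : R := \sum_p c p.1 p.2 * X p.1 p.2.

Lemma mxdotC c X : mxdot c X = mxdot X c.
Proof. by apply: eq_bigr => p _; rewrite mulrC. Qed.

Lemma mxdotDl X Y c : mxdot (X + Y) c = mxdot X c + mxdot Y c.
Proof. by rewrite -big_split; apply: eq_bigr => p _; rewrite mxE mulrDl. Qed.

Lemma mxdotDr c X Y : mxdot c (X + Y) = mxdot c X + mxdot c Y.
Proof. by rewrite mxdotC mxdotDl !(mxdotC c). Qed.

Lemma mxdot0r c : mxdot c 0 = 0.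
Proof. by apply: big1 => p _; rewrite mxE mulr0. Qed.

Lemma measurable_entry i j : measurable_fun setT (fun X => X i j : measurableTypeR R).
Proof.
move=> _ B mB; rewrite setTI; apply: sub_sigma_algebra.
by exists i, j, B.
Qed.

Lemma measurable_mxdot c : measurable_fun setT (mxdot c).
Proof.
apply: measurable_sum => p; apply: measurable_funM => //.
exact: measurable_entry.
Qed.

End dot_product.

Section gaussian_law_shift.
Context (R : realType) (m n : nat).
Implicit Types (theta c : 'M[R]_(m, n)) (E : set 'M[R]_(m, n)).

(** The likelihood ratio of the law of mean [theta'] against that of mean
    [theta]: the Gaussian normalizations cancel and the exponent is affine. *)
Definition shift_density theta theta' (X : 'M[R]_(m, n)) : R :=
  expR (mxdot (theta' - theta) X - (mxdot theta' theta' - mxdot theta theta) / 2).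

Lemma measurable_expR_affine c (k : R) :
  measurable_fun setT (fun X => expR (k + mxdot c X)).
Proof.
by apply: measurableT_comp => //; apply: measurable_funD => //; exact: measurable_mxdot.
Qed.

Lemma measurable_shift_density theta theta' :
  measurable_fun setT (shift_density theta theta').
Proof.
rewrite /shift_density; under eq_fun do rewrite addrC.
exact: measurable_expR_affine.
Qed.

Lemma shift_densityE theta theta' (t : (m * n).-tuple (measurableTypeR R)) :
  shift_density theta theta' (matrix_of_tuple t) =
  \prod_(k < m * n) likelihood_ratio (mxvec theta ord0 k) (mxvec theta' ord0 k) (tnth t k).
Proof.
rewrite -expR_sum; congr expR.
rewrite (reindex _ (curry_mxvec_bij m n))/= /mxdot -sumrB mulr_suml -sumrB.
by apply: eq_bigr => -[i j] _ /=; rewrite !mxvecE !mxE !expr2.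
Qed.

Lemma integral_gaussian_law_shift theta theta' (g : 'M[R]_(m, n) -> \bar R) :
  measurable_fun setT g -> (forall X, 0 <= g X)%E ->
  (\int[gaussian_law theta']_X g X =
   \int[gaussian_law theta]_X (g X * (shift_density theta theta' X)%:E))%E.
Proof.
move=> mg g0.
have ms := measurable_shift_density theta theta'.
rewrite [LHS]ge0_integral_distribution//.
rewrite [RHS]ge0_integral_distribution; last 2 first.
- by apply: emeasurable_funM => //; exact/measurable_EFinP.
- by move=> X; rewrite mule_ge0// lee_fin expR_ge0.
apply: etrans (integral_tuple_law_density (P := entry_law theta) (f := fun k =>
  likelihood_ratio (mxvec theta ord0 k) (mxvec theta' ord0 k)) _ _ _ _ _) _; last first.
- by apply: eq_integral => t _ /=; rewrite shift_densityE.
- by move=> t; exact: g0.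
- by apply: measurableT_comp => //; exact: measurable_matrix_of_tuple.
- by move=> k h mh h0; exact: integral_normal_prob_shift.
- by move=> k x; exact: expR_ge0.
- by move=> k; exact: measurable_likelihood_ratio.
Qed.

(** The Laplace transform of a linear statistic.  It is read off from the fact
    that the law of mean [theta + c] has total mass 1. *)
Lemma integral_expR_mxdot theta c (k : R) :
  (\int[gaussian_law theta]_X (expR (k + mxdot c X))%:E =
   (expR (k + mxdot c theta + mxdot c c / 2))%:E)%E.
Proof.
pose k' := k + mxdot c theta + mxdot c c / 2.
transitivity (\int[gaussian_law theta]_X ((expR k')%:E *
    (shift_density theta (theta + c) X)%:E))%E.
  apply: eq_integral => X _; rewrite -EFinM -expRD; congr (expR _)%:E.
  rewrite [theta + c]addrC addrK !mxdotDl !mxdotDr (mxdotC theta c) /k'.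
  by field.
rewrite -(integral_gaussian_law_shift _ _ (measurable_cst _))//; last first.
  by move=> X; rewrite lee_fin expR_ge0.
rewrite integral_cst// [X in (_ * X)%E](_ : _ = 1%E) ?mule1//.
exact: probability_setT.
Qed.

Definition Pr theta E : R := fine (gaussian_law theta E).

Lemma PrE theta E : measurable E -> (Pr theta E)%:E = gaussian_law theta E.
Proof. by move=> mE; rewrite fineK// fin_num_measure. Qed.

Lemma le_Pr theta E E' : measurable E -> measurable E' -> E `<=` E' ->
  Pr theta E <= Pr theta E'.
Proof. by move=> mE mE' EE'; rewrite -lee_fin !PrE// le_measure// inE. Qed.

Lemma Pr_setU theta E E' : measurable E -> measurable E' ->
  Pr theta (E `|` E') <= Pr theta E + Pr theta E'.
Proof.
move=> mE mE'; rewrite -lee_fin EFinD !PrE//; last exact: measurableU.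
exact: measureU2.
Qed.

Lemma Pr_setC theta E : measurable E -> Pr theta (~` E) = 1 - Pr theta E.
Proof.
move=> mE; apply: EFin_inj; rewrite EFinB !PrE//; last exact: measurableC.
by rewrite probability_setC.
Qed.

Lemma integral_indic_Pr theta E : measurable E ->
  (\int[gaussian_law theta]_X (\1_E X)%:E = (Pr theta E)%:E)%E.
Proof. by move=> mE; rewrite integral_indic// setIT PrE. Qed.

(** Markov's inequality for a sum of exponentials of affine statistics.  One
    term gives the Chernoff bound; several terms give at once the union bound
    over Chernoff bounds and the first moment bound for a mixture likelihood
    ratio. *)
Lemma gaussian_chernoff (I : Type) (s : seq I) (k : I -> R) (c : I -> 'M[R]_(m, n)) theta E :
  measurable E ->
  (forall X, E X -> 1 <= \sum_(i <- s) expR (k i + mxdot (c i) X)) ->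
  Pr theta E <= \sum_(i <- s) expR (k i + mxdot (c i) theta + mxdot (c i) (c i) / 2).
Proof.
move=> mE Es; rewrite -lee_fin -integral_indic_Pr// -sumEFin.
under [leRHS]eq_bigr do rewrite -integral_expR_mxdot.
have me i : measurable_fun setT (fun X => (expR (k i + mxdot (c i) X))%:E).
  by apply/measurable_EFinP; exact: measurable_expR_affine.
rewrite -ge0_integral_sum//.
apply: ge0_le_integral => //.
- by apply/measurable_EFinP; exact: measurable_indic.
- exact: emeasurable_sum.
- move=> X _; rewrite sumEFin lee_fin indicE.
  have [/set_mem/Es//|_] := boolP (X \in E).
  by apply: sumr_ge0 => i _; exact: expR_ge0.
Qed.

(** Where the summed likelihood ratio is at most [K], the summed probabilities
    are at most [K] times the reference one.  Used with one law to move the mean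
    of a single square, and with all squares to return to the null law. *)
Lemma gaussian_change_of_measure (I : Type) (s : seq I) (theta_ : I -> 'M[R]_(m, n)) theta K E :
  measurable E -> 0 <= K ->
  (forall X, E X -> \sum_(i <- s) shift_density theta (theta_ i) X <= K) ->
  \sum_(i <- s) Pr (theta_ i) E <= K * Pr theta E.
Proof.
move=> mE K0 EK.
have mi : measurable_fun setT (fun X => (\1_E X)%:E : \bar R).
  by apply/measurable_EFinP; exact: measurable_indic.
have mie i : measurable_fun setT
    (fun X => ((\1_E X)%:E * (shift_density theta (theta_ i) X)%:E)%E : \bar R).
  by apply: emeasurable_funM => //; apply/measurable_EFinP; exact: measurable_shift_density.
have i0 X : (0 <= (\1_E X)%:E :> \bar R)%E by rewrite lee_fin indicE ler0n.
rewrite -lee_fin EFinM -integral_indic_Pr// -sumEFin -ge0_integralZl//.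
under eq_bigr do rewrite -integral_indic_Pr// (integral_gaussian_law_shift theta)//.
rewrite -ge0_integral_sum//; last first.
  by move=> i X _; rewrite mule_ge0// lee_fin expR_ge0.
apply: ge0_le_integral => //.
- by move=> X _; apply: sume_ge0 => i _; rewrite mule_ge0// lee_fin expR_ge0.
- exact: emeasurable_sum.
- by apply: emeasurable_funM.
- move=> X _; under eq_bigr do rewrite -EFinM.
  rewrite sumEFin -EFinM lee_fin -mulr_sumr mulrC indicE.
  have [/set_mem/EK|_] := boolP (X \in E); last by rewrite !mulr0.
  by rewrite !mulr1.
Qed.

End gaussian_law_shift.

(** * Rectangles and subset counting *)

Section blocks.
Context (R : realType) (m n : nat).
Implicit Types (S : {set 'I_m * 'I_n}) (X : 'M[R]_(m, n)).

Definition flat_mx (a : R) S : 'M[R]_(m, n) :=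
  \matrix_(i, j) if (i, j) \in S then a else 0.

Lemma mxdot_flat a S X : mxdot (flat_mx a S) X = a * \sum_(p in S) X p.1 p.2.
Proof.
rewrite /mxdot mulr_sumr [RHS]big_mkcond; apply: eq_bigr => -[i j] _ /=.
by rewrite mxE; case: ifP => // _; rewrite mul0r.
Qed.

Lemma mxdot_flat2 a b S S' :
  mxdot (flat_mx a S) (flat_mx b S') = a * b * #|S :&: S'|%:R.
Proof.
rewrite mxdot_flat -mulrA; congr (_ * _).
rewrite -sumr_const [in RHS](eq_bigl (fun p => (p \in S) && (p \in S'))); last first.
  by move=> p; rewrite finset.in_setI.
rewrite [in RHS]big_mkcondr mulr_sumr; apply: eq_bigr => -[i j] _ /=.
rewrite mxE /=. by case: ifP; rewrite ?mulr1 ?mulr0.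
Qed.

Lemma flat_mxB a b S : flat_mx a S - flat_mx b S = flat_mx (a - b) S.
Proof. by apply/matrixP => i j; rewrite !mxE; case: ifP => // _; rewrite subr0. Qed.

End blocks.

Lemma setIX_rect (I J : finType) (A A' : {set I}) (B B' : {set J}) :
  finset.setX A B :&: finset.setX A' B' = finset.setX (A :&: A') (B :&: B').
Proof. by apply/setP => -[i j]; rewrite !finset.inE /= andbACA. Qed.

Section subset_sums.
Context (R : realType) (N : nat).

(** The sum is part of the expansion of the product of the [1 + w i]. *)
Lemma sum_subset_prod_le (n : nat) (w : 'I_N -> R) : (forall i, 0 <= w i) ->
  \sum_(A : {set 'I_N} | #|A| == n) \prod_(i in A) w i <= expR (\sum_i w i).
Proof.
move=> w0; apply: (@le_trans _ _ (\prod_i (w i + 1))).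
  rewrite bigA_distr [leRHS](bigID (fun A : {set 'I_N} => #|A| == n)) /=.
  under [X in _ <= X + _]eq_bigr => A _.
    rewrite (bigID (mem A)) /= [X in X * _](_ : _ = \prod_(i in A) w i); last first.
      by apply: eq_bigr => i ->.
    rewrite [X in _ * X]big1 ?mulr1; last by move=> i /negbTE ->.
    over.
  rewrite lerDl; apply: sumr_ge0 => A _; apply: prodr_ge0 => i _.
  by case: ifP.
rewrite expR_sum; apply: ler_prod => i _.
by rewrite addr_ge0 ?w0//= addrC expR_ge1Dx.
Qed.

(** Fixing [#|B| = n], the term is [q ^+ n] times a product over [B] of weights
    equal to 1 on [A] and to [q^-1] off [A].  The total weight is at most
    [n + N / q <= 2 n], which is what the hypothesis on [q] is for. *)
Lemma sum_overlap_le (n : nat) (q : R) (A : {set 'I_N}) : 0 < q ->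
  N%:R <= n%:R * q -> #|A| = n ->
  \sum_(B : {set 'I_N} | #|B| == n) q ^+ #|A :&: B| <= q ^+ n * expR (2 * n%:R).
Proof.
move=> q0 Nq An; pose w i : R := if i \in A then 1 else q^-1.
have w0 i : 0 <= w i by rewrite /w; case: ifP => // _; rewrite invr_ge0 ltW.
have wE (B : {set 'I_N}) : #|B| == n ->
    q ^+ #|A :&: B| = q ^+ n * \prod_(i in B) w i.
  move=> /eqP Bn; rewrite (bigID (mem A)) /=.
  rewrite [X in _ * (X * _)]big1 ?mul1r; last first.
    by move=> i /andP[_ iA]; rewrite /w iA.
  rewrite (eq_bigr (fun=> q^-1)); last by move=> i /andP[_ /negbTE iA]; rewrite /w iA.
  rewrite (eq_bigl (mem (B :\: A))); last by move=> i; rewrite /= finset.inE andbC.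
  rewrite prodr_const -Bn -(cardsID A B) finset.setIC exprD exprVn -mulrA divff ?mulr1//.
  by rewrite expf_neq0// gt_eqF.
rewrite (eq_bigr _ wE) -mulr_sumr ler_pM2l ?exprn_gt0//.
apply: (le_trans (sum_subset_prod_le n w0)); rewrite ler_expR.
rewrite (bigID (mem A)) /= (eq_bigr (fun=> 1)); last by move=> i iA; rewrite /w iA.
rewrite sumr_const An mulr_natl mulr2n lerD2l.
rewrite (eq_bigr (fun=> q^-1)); last by move=> i /negbTE iA; rewrite /w iA.
apply: (@le_trans _ _ (\sum_(i < N) q^-1)).
  rewrite [leRHS](bigID (mem A)) /= lerDr sumr_ge0// => i _.
  by rewrite invr_ge0 ltW.
by rewrite sumr_const card_ord -[_ *+ _]mulr_natl ler_pdivrMr.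
Qed.

(** This is the usual bound of C(N, n) by (e N / n)^n: it is
    [sum_subset_prod_le] for constant weights n / N. *)
Lemma bin_le_expR (n : nat) : (0 < n <= N)%N ->
  'C(N, n)%:R * (n%:R / N%:R) ^+ n <= expR n%:R :> R.
Proof.
move=> /andP[n0 nN]; have N0 : (0 < N)%N by exact: leq_trans nN.
pose z : R := n%:R / N%:R.
have z0 : 0 <= z by rewrite divr_ge0.
have := @sum_subset_prod_le n (fun=> z) (fun=> z0).
rewrite sumr_const card_ord (eq_bigr (fun=> z ^+ n)); last first.
  by move=> A /eqP An; rewrite prodr_const An.
rewrite sumr_const -[_ *+ _]mulr_natl -[z *+ _]mulr_natl /z mulrCA divff ?mulr1//; last first.
  by rewrite pnatr_eq0 -lt0n.
have -> : #|[pred A : {set 'I_N} | #|A| == n]| = 'C(N, n).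
  by have := card_draws 'I_N n; rewrite card_ord cardsE => <-.
by [].
Qed.

End subset_sums.

Lemma expn_le_bin (n N : nat) : (n <= N)%N -> (N ^ n <= 'C(N, n) * n ^ n)%N.
Proof.
move=> nN; rewrite -(leq_pmul2r (fact_gt0 n)) mulnAC bin_ffact.
rewrite -[n`!]ffactnn !ffact_prod -[in X in (X * _ <= _)%N](card_ord n) -prod_nat_const.
rewrite -[in X in (_ <= _ * X)%N](card_ord n) -prod_nat_const -!big_split /=.
apply: leq_prod => i _.
by rewrite card_ord mulnBl mulnBr leq_sub2l// mulnC leq_mul2r nN orbT.
Qed.

(** * The scan test *)

Section scan_index.
Context (N : nat).

Definition rect : finType := ({set 'I_N} * {set 'I_N})%type.

Definition cells (U : rect) : {set 'I_N * 'I_N} := finset.setX U.1 U.2.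

Definition squares (n : nat) : {set rect} :=
  [set U : rect | (#|U.1| == n) && (#|U.2| == n)]%SET.

Lemma squaresP n (U : rect) : U \in squares n -> #|U.1| = n /\ #|U.2| = n.
Proof. by rewrite finset.inE => /andP[/eqP-> /eqP->]. Qed.

Lemma card_cells (U : rect) : #|cells U| = (#|U.1| * #|U.2|)%N.
Proof. exact: cardsX. Qed.

Lemma cellsI (U V : rect) : cells U :&: cells V = cells (U.1 :&: V.1, U.2 :&: V.2).
Proof. exact: setIX_rect. Qed.

Lemma card_squares n : #|squares n| = ('C(N, n) ^ 2)%N.
Proof.
have -> : squares n = finset.setX [set A : {set 'I_N} | #|A| == n]%SET
                                  [set A : {set 'I_N} | #|A| == n]%SET.
  by apply/setP => U; rewrite !finset.inE.
by rewrite cardsX !card_draws card_ord mulnn.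
Qed.

Lemma sum_squares (R : realType) n (f g : {set 'I_N} -> R) :
  \sum_(U in squares n) f U.1 * g U.2 =
  (\sum_(A : {set 'I_N} | #|A| == n) f A) * (\sum_(A : {set 'I_N} | #|A| == n) g A).
Proof.
rewrite big_distrlr /= pair_big /=; apply: eq_bigl => U.
by rewrite finset.inE.
Qed.

End scan_index.

Section scan_sums.
Context (R : realType) (N : nat).
Implicit Types (U V : rect N) (X : 'M[R]_N).

Definition cell_sum U X : R := \sum_(p in cells U) X p.1 p.2.

Lemma mxdot_cells (a : R) U X : mxdot (flat_mx a (cells U)) X = a * cell_sum U X.
Proof. exact: mxdot_flat. Qed.

Lemma cell_sum_flat (a : R) U : cell_sum U (flat_mx a (cells U)) = a * #|cells U|%:R.
Proof.
by rewrite -[LHS]mul1r -mxdot_cells mxdot_flat2 mul1r finset.setIid.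
Qed.

Lemma measurable_cell_sum U : measurable_fun setT (cell_sum U).
Proof.
rewrite (_ : cell_sum U = mxdot (flat_mx 1 (cells U))); first exact: measurable_mxdot.
by apply/funext => X; rewrite mxdot_cells mul1r.
Qed.

Lemma measurable_cell_sum_ge U (a : R) : measurable [set X : 'M[R]_N | a <= cell_sum U X].
Proof.
rewrite -[X in measurable X]setTI.
rewrite (_ : [set X | _] = cell_sum U @^-1` `[a, +oo[%classic); last first.
  by apply/seteqP; split=> X /=; rewrite in_itv/= andbT.
exact: measurable_cell_sum.
Qed.

Definition scan_region n (a : R) : set 'M[R]_N :=
  \bigcup_(U in [set` squares N n]) [set X | a <= cell_sum U X].

Lemma measurable_scan_region n (a : R) : measurable (scan_region n a).
Proof.
apply: fin_bigcup_measurable => [|U _]; first exact: finite_finset.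
exact: measurable_cell_sum_ge.
Qed.

Lemma risk_le_test n (A r : R) (E : set 'M[R]_N) : measurable E ->
  (forall theta, Theta A n N theta -> Pr 0 E + Pr theta (~` E) <= r) -> 0 <= r - Pr 0 E ->
  (minimax_risk n N A <= r%:E)%E.
Proof.
move=> mE Er r0; pose T (X : 'M[R]_N) : bool := `[< E X >].
have TE : T @^-1` [set true] = E.
  by apply/seteqP; split=> X /=; [move/asboolP|move=> ?; exact/asboolP].
have TcE : T @^-1` [set false] = ~` E.
  by apply/seteqP; split=> X /=; [move/negbT/asboolPn|move=> ?; exact/negbTE/asboolPn].
have mT : measurable_fun setT T.
  by apply: (measurable_fun_bool true); rewrite setTI TE.
pose T' : {mfun 'M[R]_N >-> bool} := HB.pack T (isMeasurableFun.Build _ _ _ _ T mT).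
apply: (@le_trans _ _ ((Pr 0 E)%:E + (r - Pr 0 E)%:E)%E); last first.
  by rewrite -EFinD addrCA subrr addr0.
apply: (@le_trans _ _ (gaussian_law (0 : 'M[R]_N) (T @^-1` [set true]) +
                  ereal_sup [set gaussian_law theta (T @^-1` [set false])
                            | theta in Theta A n N])%E).
  by apply: ereal_inf_lbound; exists T'.
rewrite TE TcE PrE// leeD2l//; apply: ub_ereal_sup => _ [theta /Er Hth <-].
by rewrite -PrE//; [rewrite lee_fin lerBrDl|exact: measurableC].
Qed.

(** Both errors are Chernoff bounds with the tilt that is optimal for the
    threshold [n t]: [t / n] per cell under the null law, and [- (d - t) / n]
    per cell of the planted square, where [d = n A]. *)
Lemma scan_test_risk n (A t : R) : (0 < n)%N -> 0 <= t <= n%:R * A ->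
  (minimax_risk n N A <=
   ('C(N, n)%:R ^+ 2 * expR (- (t ^+ 2 / 2)) + expR (- ((n%:R * A - t) ^+ 2 / 2)))%:E)%E.
Proof.
move=> n0 /andP[t0 td].
have nR : (n%:R : R) != 0 by rewrite pnatr_eq0 -lt0n.
pose E := scan_region n (n%:R * t).
have mE : measurable E by exact: measurable_scan_region.
have PrE0 : Pr 0 E <= 'C(N, n)%:R ^+ 2 * expR (- (t ^+ 2 / 2)).
  apply: (le_trans (gaussian_chernoff (s := enum (squares N n)) (k := fun=> - t ^+ 2)
    (c := fun U => flat_mx (t / n%:R) (cells U)) 0 mE _)).
    move=> X [U /= UK tU]; rewrite big_enum /= (bigD1 U)//=.
    rewrite -[leLHS]addr0; apply: lerD; last by apply: sumr_ge0 => V _; exact: expR_ge0.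
    rewrite -[leLHS]expR0 ler_expR mxdot_cells /=.
    have -> : - t ^+ 2 + t / n%:R * cell_sum U X =
      t / n%:R * (cell_sum U X - n%:R * t) by field.
    by rewrite mulr_ge0 ?divr_ge0// subr_ge0.
  rewrite big_enum /= (eq_bigr (fun=> expR (- (t ^+ 2 / 2)))).
    by rewrite sumr_const card_squares -[_ *+ _]mulr_natl natrX.
  move=> U /squaresP[U1 U2]; rewrite mxdot0r mxdot_flat2 finset.setIid card_cells U1 U2.
  by rewrite natrM; congr expR; field.
apply: (risk_le_test mE) => [theta [Rw [Cl [cR cC tA _]]]|]; last first.
  by rewrite subr_ge0 (le_trans PrE0)// lerDl expR_ge0.
apply: lerD => //.
pose U : rect N := (Rw, Cl).
have UK : U \in squares N n by rewrite finset.inE /= cR cC eqxx.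
have cU : (#|cells U|%:R : R) = n%:R * n%:R by rewrite card_cells /= cR cC natrM.
pose g := n%:R * A - t.
have g0 : 0 <= g by rewrite subr_ge0.
apply: (le_trans (gaussian_chernoff (s := [:: tt]) (k := fun=> g * t)
    (c := fun=> flat_mx (- (g / n%:R)) (cells U)) theta (measurableC mE) _)).
  move=> X /= nE; rewrite big_seq1 -[leLHS]expR0 ler_expR mxdot_cells /=.
  have : cell_sum U X < n%:R * t.
    by rewrite ltNge; apply/negP => tU; apply: nE; exists U.
  have -> : g * t + - (g / n%:R) * cell_sum U X = g / n%:R * (n%:R * t - cell_sum U X).
    by field.
  by move=> h; rewrite mulr_ge0 ?divr_ge0// subr_ge0 ltW.
rewrite big_seq1 ler_expR mxdot_cells mxdot_flat2 finset.setIid cU /=.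
have sA : n%:R * n%:R * A <= cell_sum U theta.
  rewrite -cU mulr_natl -sumr_const; apply: ler_sum => -[i j] ij; exact: tA.
have : g / n%:R * (n%:R * n%:R * A) <= g / n%:R * cell_sum U theta.
  by rewrite ler_wpM2l// divr_ge0.
have -> : g / n%:R * (n%:R * n%:R * A) = g * (n%:R * A) by field.
have -> : - (g / n%:R) * - (g / n%:R) * (n%:R * n%:R) = g ^+ 2 by field.
rewrite mulNr (_ : n%:R * A = g + t); last by rewrite /g subrK.
move=> h; lra.
Qed.

End scan_sums.

(** * The lower bound *)

Section exp_constants.
Context (R : realType).

Lemma expR1_ge2 : 2 <= expR 1 :> R.
Proof. by apply: le_trans (expR_ge1Dx 1); lra. Qed.

Lemma expRN_le_half (n : nat) : expR (- n%:R) <= (1 / 2) ^+ n :> R.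
Proof.
rewrite -[n%:R]mulr1 -mulrN expRM_natl lerXn2r ?nnegrE ?expR_ge0 ?divr_ge0//.
by rewrite expRN div1r lef_pV2 ?posrE ?expR_gt0 ?ltr0n// expR1_ge2.
Qed.

End exp_constants.

Section lower_bound.
Context (R : realType) (n N : nat).
Hypotheses (n_gt0 : (0 < n)%N) (n_leN : (n <= N)%N).
Variables (A t : R).
Local Notation d := (n%:R * A).
Local Notation M := ('C(N, n)%:R : R).
Hypotheses (t_ge0 : 0 <= t) (t_led : t <= d).
Hypothesis tdE : 2 * ln M = t * d - d ^+ 2 / 2.

Let nR_gt0 : (0 : R) < n%:R. Proof. by rewrite ltr0n. Qed.
Let nR_neq0 : (n%:R : R) != 0. Proof. by rewrite gt_eqF. Qed.
Let M_ge1 : 1 <= M. Proof. by rewrite ler1n bin_gt0. Qed.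
Let M_gt0 : 0 < M. Proof. exact: lt_le_trans M_ge1. Qed.

(** The planted mean of the interpolating law, between 0 and [A]. *)
Let B := t / n%:R.
Let s : R := Num.sqrt n%:R.
Let s_ge0 : 0 <= s. Proof. exact: sqrtr_ge0. Qed.
Let s_gt0 : 0 < s. Proof. by rewrite sqrtr_gt0. Qed.
Let s2 : s ^+ 2 = n%:R. Proof. by rewrite sqr_sqrtr. Qed.
Let s_ge1 : 1 <= s.
Proof. by rewrite -sqrtr1 ler_wsqrtr// ler1n. Qed.

Let kappa := (d - t) ^+ 2 / 2.
Let K := kappa + 4 * s * d + 4 * n%:R + 3.

(** The [n]-th root of [M]: sharing one row with the planted square costs a
    factor [q] in the number of competitors. *)
Let q := expR (ln M / n%:R).

Let qXn : q ^+ n = M.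
Proof.
by rewrite /q -expRM_natl mulrCA divff// mulr1 lnK// posrE.
Qed.

Let N_le_nq : N%:R <= n%:R * q.
Proof.
rewrite -ler_pdivrMl// -(@ler_pXn2r _ n)// ?nnegrE ?expR_ge0 ?mulr_ge0 ?invr_ge0//.
rewrite qXn exprMn exprVn ler_pdivrMl ?exprn_gt0// mulrC -natrX -natrX -natrM ler_nat.
exact: expn_le_bin.
Qed.

(** The energy gained by sharing [k] rows and [l] columns is paid for by the
    rarity of such overlaps, up to [kappa]. *)
Let overlap_exponent (k l : nat) : (k <= n)%N -> (l <= n)%N ->
  expR (B ^+ 2 * (k * l)%:R / 2) <= expR kappa * (q ^+ k * q ^+ l).
Proof.
move=> kn l_n; rewrite /q -!expRM_natl -!expRD ler_expR natrM.
pose x : R := k%:R / n%:R; pose y : R := l%:R / n%:R.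
have x0 : 0 <= x by rewrite divr_ge0.
have y0 : 0 <= y by rewrite divr_ge0.
have x1 : x <= 1 by rewrite ler_pdivrMr// mul1r ler_nat.
have y1 : y <= 1 by rewrite ler_pdivrMr// mul1r ler_nat.
have -> : B ^+ 2 * (k%:R * l%:R) / 2 = t ^+ 2 / 2 * (x * y).
  by rewrite /B /x /y; field.
pose L := 2 * ln M.
have -> : k%:R * (ln M / n%:R) = L * x / 2 by rewrite /L /x; field.
have -> : l%:R * (ln M / n%:R) = L * y / 2 by rewrite /L /y; field.
have L0 : 0 <= L by rewrite mulr_ge0// ln_ge0.
have kE : kappa = t ^+ 2 / 2 - L by rewrite /kappa /L tdE; field.
have kap0 : 0 <= kappa by rewrite divr_ge0// sqr_ge0.
rewrite kE in kap0 *.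
(* The slack is (t^2/2 - L) (1 - x y) + L (x (1 - y) + y (1 - x)) / 2. *)
have xy1 : x * y <= 1 by nra.
have : 0 <= (t ^+ 2 / 2 - L) * (1 - x * y) by rewrite mulr_ge0// subr_ge0.
have : 0 <= L * (x * (1 - y) + y * (1 - x)).
  by rewrite mulr_ge0// addr_ge0// mulr_ge0// subr_ge0.
by lra.
Qed.

Let Q (U : rect N) := flat_mx B (cells U).

Let square_cells (U : rect N) : U \in squares N n -> (#|cells U|%:R : R) = n%:R * n%:R.
Proof. by move=> /squaresP[U1 U2]; rewrite card_cells U1 U2 natrM. Qed.

(** Four standard deviations of the sum over the square: its variance is
    [n ^ 2]. *)
Let low_dev (U : rect N) : U \in squares N n ->
  Pr (Q U) (~` [set X | n%:R * n%:R * B - 4 * n%:R <= cell_sum U X]) <= 1 / 8.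
Proof.
move=> UK; have cU := square_cells UK.
apply: (le_trans (gaussian_chernoff (s := [:: tt])
    (k := fun=> 4 / n%:R * (n%:R * n%:R * B - 4 * n%:R))
    (c := fun=> flat_mx (- (4 / n%:R)) (cells U)) (Q U) _ _)).
- by apply: measurableC; exact: measurable_cell_sum_ge.
- move=> X /= /negP; rewrite -ltNge => h.
  rewrite big_seq1 -[leLHS]expR0 ler_expR mxdot_cells /= mulNr -mulrBr.
  by rewrite mulr_ge0 ?divr_ge0// subr_ge0 ltW.
rewrite big_seq1 mxdot_cells cell_sum_flat mxdot_flat2 finset.setIid cU.
apply: (@le_trans _ _ (expR (- 3%:R))).
  rewrite ler_expR.
  have -> : 4 / n%:R * (n%:R * n%:R * B - 4 * n%:R) +
    - (4 / n%:R) * (B * (n%:R * n%:R)) +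
    - (4 / n%:R) * - (4 / n%:R) * (n%:R * n%:R) / 2 = - 8 by field.
  by lra.
apply: le_trans (expRN_le_half _ _) _; rewrite !exprS expr0; lra.
Qed.

Let subrects (U : rect N) : {set rect N} :=
  [set V : rect N | (V.1 \subset U.1) && (V.2 \subset U.2)]%SET.

(** The matrices for which some subrectangle of [U] has an abnormally large sum
    for the law of mean [Q U]. *)
Let wild (U : rect N) : set 'M[R]_N :=
  \bigcup_(V in [set` subrects U]) [set X | B * #|cells V|%:R + 4 * n%:R * s <= cell_sum V X].

Let measurable_wild U : measurable (wild U).
Proof.
apply: fin_bigcup_measurable => [|V _]; first exact: finite_finset.
exact: measurable_cell_sum_ge.
Qed.

(** A subrectangle sum has variance at most n^2, so a deviation of 4 n^(3/2) has
    probability at most exp (- 8 n), which beats the 4^n subrectangles. *)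
Let wild_dev (U : rect N) : U \in squares N n -> Pr (Q U) (wild U) <= 1 / 8.
Proof.
move=> UK; have [U1 U2] := squaresP UK.
apply: (le_trans (gaussian_chernoff (s := enum (subrects U))
    (k := fun V => - (4 / s * (B * #|cells V|%:R + 4 * n%:R * s)))
    (c := fun V => flat_mx (4 / s) (cells V)) (Q U) (measurable_wild U) _)).
  move=> X [V /= VU hV]; rewrite big_enum /= (bigD1 V)//=.
  rewrite -[leLHS]addr0; apply: lerD; last by apply: sumr_ge0 => ? _; exact: expR_ge0.
  rewrite -[leLHS]expR0 ler_expR mxdot_cells /= addrC -mulrBr.
  by rewrite mulr_ge0 ?divr_ge0// subr_ge0.
rewrite big_enum /=.
apply: (@le_trans _ _ (\sum_(V in subrects U) expR (- (8 * n%:R)))).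
  apply: ler_sum => V; rewrite finset.inE => /andP[VU1 VU2].
  have VU : cells V :&: cells U = cells V.
    by rewrite cellsI (finset.setIidPl VU1) (finset.setIidPl VU2); case: (V).
  have cV : (#|cells V|%:R : R) <= n%:R * n%:R.
    rewrite -natrM ler_nat card_cells -[X in (_ <= X * _)%N]U1 -U2.
    by rewrite leq_mul// subset_leq_card.
  rewrite ler_expR !mxdot_flat2 finset.setIid VU.
  have -> : - (4 / s * (B * #|cells V|%:R + 4 * n%:R * s)) + 4 / s * B * #|cells V|%:R =
    - 16 * n%:R by field; rewrite gt_eqF.
  have -> : 4 / s * (4 / s) * #|cells V|%:R / 2 = 8 / n%:R * #|cells V|%:R.
    by rewrite -s2; field; rewrite gt_eqF.
  have : 8 / n%:R * #|cells V|%:R <= 8 / n%:R * (n%:R * n%:R) :> R.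
    by rewrite ler_wpM2l// divr_ge0.
  have -> : 8 / n%:R * (n%:R * n%:R) = 8 * n%:R :> R by field.
  by lra.
rewrite sumr_const.
have -> : #|subrects U| = (4 ^ n)%N.
  have -> : subrects U = finset.setX (powerset U.1) (powerset U.2).
    by apply/setP => V; rewrite !finset.inE.
  by rewrite cardsX !card_powerset U1 U2 -expnMn.
have e4 : (4 ^ n)%:R <= expR (2 * n%:R) :> R.
  rewrite mulrC expRM_natl natrX lerXn2r ?nnegrE ?expR_ge0//.
  rewrite (_ : 2 = 1 + 1)// expRD; have := expR1_ge2 R; nra.
rewrite -[leLHS]mulr_natl; apply: (@le_trans _ _ (expR (2 * n%:R) * expR (- (8 * n%:R)))).
  by rewrite ler_wpM2r ?expR_ge0.
rewrite -expRD; apply: (@le_trans _ _ (expR (- 3%:R))).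
  rewrite ler_expR; have : (1 : R) <= n%:R by rewrite ler1n.
  by lra.
apply: le_trans (expRN_le_half _ _) _; rewrite !exprS expr0; lra.
Qed.

(** The likelihood ratio of the mixture against the null law, multiplied by
    the number of squares. *)
Let LR (X : 'M[R]_N) := \sum_(U <- enum (squares N n)) shift_density 0 (Q U) X.

Let LRE X : LR X = \sum_(U in squares N n) expR (B * cell_sum U X - t ^+ 2 / 2).
Proof.
rewrite /LR big_enum; apply: eq_bigr => U UK; congr expR.
rewrite subr0 mxdot_cells mxdot0r subr0 mxdot_flat2 finset.setIid square_cells//.
by rewrite /B; field.
Qed.

Let measurable_LR : measurable_fun setT LR.
Proof. by apply: measurable_sum => U; exact: measurable_shift_density. Qed.

Let W := M ^+ 2 * expR K.

Let W_gt0 : 0 < W. Proof. by rewrite mulr_gt0 ?exprn_gt0 ?expR_gt0. Qed.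

Let big_LR := [set X : 'M[R]_N | W <= LR X].

Let measurable_big_LR : measurable big_LR.
Proof.
rewrite -[X in measurable X]setTI.
rewrite (_ : big_LR = LR @^-1` `[W, +oo[%classic); last first.
  by apply/seteqP; split=> X /=; rewrite in_itv/= andbT.
exact: measurable_LR.
Qed.

(** Off [wild U], the part of a competing square [V] that meets [U] has a sum
    bounded by its mean plus 4 n^(3/2); only the cells of [V] outside [U], which
    are centred, are averaged.  Replacing the Gaussian moment on the overlap by
    this deterministic bound halves its exponent, from B^2 k l to B^2 k l / 2
    after the normalization of the likelihood ratio. *)
Let LR_dev (U : rect N) : U \in squares N n ->
  Pr (Q U) (~` wild U `&` big_LR) <= 1 / 8.
Proof.
move=> UK; have [U1 U2] := squaresP UK.
have mE : measurable (~` wild U `&` big_LR).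
  by apply: measurableI => //; exact: measurableC.
(* o V is the size of the overlap; k V collects all that is deterministic. *)
pose o V : R := #|cells (V.1 :&: U.1, V.2 :&: U.2) : {set 'I_N * 'I_N}|%:R.
pose k V := - ln W + B * (B * o V + 4 * n%:R * s) - t ^+ 2 / 2.
apply: (le_trans (gaussian_chernoff (s := enum (squares N n))
    (k := k) (c := fun V => flat_mx B (cells V :\: cells U)) (Q U) mE _)).
  move=> X [/= nwild]; rewrite /big_LR /= -[leLHS]mulr1 -ler_pdivlMl// LRE => h.
  apply: (le_trans h); rewrite big_enum /= mulr_sumr; apply: ler_sum => V VK.
  rewrite -[W^-1]lnK ?posrE ?invr_gt0// lnV ?posrE// -expRD ler_expR mxdot_flat /k.
  have -> : cell_sum V X = cell_sum (V.1 :&: U.1, V.2 :&: U.2) X +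
      \sum_(p in cells V :\: cells U) X p.1 p.2.
    rewrite /cell_sum -cellsI; exact: big_setID.
  have : cell_sum (V.1 :&: U.1, V.2 :&: U.2) X <= B * o V + 4 * n%:R * s.
    apply: ltW; rewrite ltNge; apply/negP => hw; apply: nwild.
    by exists (V.1 :&: U.1, V.2 :&: U.2) => //=; rewrite finset.inE /= !finset.subsetIr.
  have B0 : 0 <= B by rewrite divr_ge0.
  move=> /(ler_wpM2l B0); rewrite mulrDr; lra.
rewrite big_enum /=.
apply: (@le_trans _ _ (\sum_(V in squares N n)
    (W^-1 * expR (4 * s * t) * expR kappa) *
    (q ^+ #|U.1 :&: V.1| * q ^+ #|U.2 :&: V.2|))).
  apply: ler_sum => V VK; have [V1 V2] := squaresP VK.
  rewrite !mxdot_flat2 finset.setIid finset.setIDAC finset.setDIl finset.setDv finset.setI0.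
  rewrite finset.cards0 mulr0 addr0.
  have oE : o V = (#|U.1 :&: V.1| * #|U.2 :&: V.2|)%:R.
    by rewrite /o card_cells /= !(finset.setIC V.1) !(finset.setIC V.2).
  have -> : (#|cells V :\: cells U|%:R : R) = n%:R * n%:R - o V.
    rewrite -(square_cells VK) -(cardsID (cells U) (cells V)) natrD cellsI /o.
    by rewrite addrAC subrr add0r.
  have -> : k V + B * B * (n%:R * n%:R - o V) / 2 =
      - ln W + (4 * s * t + B ^+ 2 * o V / 2).
    by rewrite /k /B; field.
  have : expR (B ^+ 2 * o V / 2) <=
      expR kappa * (q ^+ #|U.1 :&: V.1| * q ^+ #|U.2 :&: V.2|).
    rewrite oE; apply: (@overlap_exponent #|U.1 :&: V.1| #|U.2 :&: V.2|).
      by rewrite -[X in (_ <= X)%N]U1 subset_leq_card// finset.subsetIl.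
    by rewrite -[X in (_ <= X)%N]U2 subset_leq_card// finset.subsetIl.
  move=> overlap; rewrite 2!expRD expRN lnK ?posrE// -[leRHS]mulrA -[leRHS]mulrA.
  by rewrite ler_pM2l ?invr_gt0// ler_pM2l ?expR_gt0.
rewrite -mulr_sumr (sum_squares n (fun A => q ^+ #|U.1 :&: A|) (fun A => q ^+ #|U.2 :&: A|)).
have q0 : 0 < q by rewrite expR_gt0.
have S1 := sum_overlap_le q0 N_le_nq U1.
have S2 := sum_overlap_le q0 N_le_nq U2.
rewrite qXn in S1 S2.
apply: (@le_trans _ _ (W^-1 * expR (4 * s * t) * expR kappa *
    ((M * expR (2 * n%:R)) * (M * expR (2 * n%:R))))).
  rewrite ler_wpM2l ?mulr_ge0 ?invr_ge0 ?expR_ge0 ?(ltW W_gt0)//.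
  by apply: ler_pM => //; apply: sumr_ge0 => ? _; rewrite exprn_ge0// ltW.
have -> : W^-1 * expR (4 * s * t) * expR kappa *
    ((M * expR (2 * n%:R)) * (M * expR (2 * n%:R))) =
    expR (- K + (4 * s * t + kappa + (2 * n%:R + 2 * n%:R))).
  rewrite !expRD expRN /W; field.
  by rewrite !gt_eqF// ?expR_gt0.
apply: (@le_trans _ _ (expR (- 3%:R))).
  rewrite ler_expR /K.
  have : 4 * s * t <= 4 * s * d by rewrite ler_wpM2l// mulr_ge0.
  by lra.
apply: le_trans (expRN_le_half _ _) _; rewrite !exprS expr0; lra.
Qed.

(** A missed signal of mean [B] on [U] is nearly as likely for mean [A]: where
    the sum over [U] is not abnormally low, the likelihood ratio of the two laws
    is at most exp ((d - t)^2 / 2 + 4 (d - t)). *)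
Let accept_cost (U : rect N) (E : set 'M[R]_N) : U \in squares N n -> measurable E ->
  Pr (Q U) E <= expR K * Pr (flat_mx A (cells U)) E + 1 / 8.
Proof.
move=> UK mE; have cU := square_cells UK.
pose G := [set X | n%:R * n%:R * B - 4 * n%:R <= cell_sum U X].
have mG : measurable G by exact: measurable_cell_sum_ge.
have mEG : measurable (E `&` G) by exact: measurableI.
apply: (@le_trans _ _ (Pr (Q U) (E `&` G) + Pr (Q U) (~` G))).
  apply: le_trans (Pr_setU _ mEG (measurableC mG)).
  apply: le_Pr => //; first by apply: measurableU => //; exact: measurableC.
  by move=> X EX; have [GX|nGX] := pselect (G X); [left|right].
apply: lerD; last exact: low_dev.
apply: (@le_trans _ _ (expR K * Pr (flat_mx A (cells U)) (E `&` G))); last first.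
  by rewrite ler_wpM2l ?expR_ge0//; apply: le_Pr => // X [].
have := @gaussian_change_of_measure R N N unit [:: tt] (fun=> Q U) (flat_mx A (cells U))
  (expR K) (E `&` G) mEG (expR_ge0 _).
rewrite big_seq1; apply => X [_ GX]; rewrite big_seq1 ler_expR flat_mxB mxdot_cells.
rewrite !mxdot_flat2 finset.setIid cU.
have AB : 0 <= A - B.
  by rewrite subr_ge0 ler_pdivrMr// mulrC.
have := ler_wpM2l AB GX.
have dE : (A - B) * n%:R = d - t by rewrite /B; field.
have -> : (A - B) * (n%:R * n%:R * B - 4 * n%:R) = (d - t) * t - 4 * (d - t).
  by rewrite -dE /B; field.
have -> : (B * B * (n%:R * n%:R) - A * A * (n%:R * n%:R)) / 2 = (t ^+ 2 - d ^+ 2) / 2.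
  by rewrite /B; field.
rewrite /K /kappa.
have d0 : 0 <= d by exact: le_trans t_led.
have : d <= s * d by rewrite ler_peMl.
have := ltW nR_gt0.
have -> : (B - A) * cell_sum U X = - ((A - B) * cell_sum U X) by rewrite -mulNr opprB.
move: t_ge0 ((A - B) * cell_sum U X) => h0 u h1 h2 h3; lra.
Qed.

(** Rejections under the mixture come from three sources: a wild planted square,
    a large likelihood ratio, and the rest, which the null law also sees. *)
Let reject_cost (E : set 'M[R]_N) : measurable E ->
  \sum_(U in squares N n) Pr (Q U) E <= M ^+ 2 * (expR K * Pr 0 E + 1 / 4).
Proof.
move=> mE; pose F := E `&` ~` big_LR.
have mF : measurable F by apply: measurableI => //; exact: measurableC.
have cK : (#|squares N n|%:R : R) = M ^+ 2 by rewrite card_squares natrX.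
apply: (@le_trans _ _ (\sum_(U in squares N n) (Pr (Q U) F + 1 / 4))).
  apply: ler_sum => U UK.
  have mW := measurable_wild U.
  have mG : measurable (~` wild U `&` big_LR) by apply: measurableI => //; exact: measurableC.
  apply: (@le_trans _ _ (Pr (Q U) (F `|` (wild U `|` (~` wild U `&` big_LR))))).
    apply: le_Pr => //; first by apply: measurableU => //; exact: measurableU.
    move=> X EX; have [h|h] := pselect (big_LR X); last by left.
    by right; have [h'|h'] := pselect (wild U X); [left|right].
  apply: le_trans (Pr_setU _ mF (measurableU _ _ mW mG)) _.
  rewrite lerD2l; apply: le_trans (Pr_setU _ mW mG) _.
  by have := wild_dev UK; have := LR_dev UK; lra.
rewrite big_split /= sumr_const -[_ *+ _]mulr_natl cK mulrDr lerD2r mulrA -/W.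
apply: (@le_trans _ _ (W * Pr 0 F)); last first.
  by rewrite ler_wpM2l ?(ltW W_gt0)//; apply: le_Pr => // X [].
rewrite -big_enum /=; apply: gaussian_change_of_measure => //; first exact: ltW.
by move=> X [_ /negP]; rewrite -ltNge => /ltW.
Qed.

(** Averaging [accept_cost] and [reject_cost] over the squares: were all sums of
    errors below exp (- K) / 2, the mixture would have total mass at most 7/8. *)
Lemma some_square_hard (E : set 'M[R]_N) : measurable E ->
  exists2 U : rect N, U \in squares N n &
    expR (- K) / 2 <= Pr 0 E + Pr (flat_mx A (cells U)) (~` E).
Proof.
move=> mE.
have [//|h] := pselect (exists2 U : rect N, U \in squares N n &
    expR (- K) / 2 <= Pr 0 E + Pr (flat_mx A (cells U)) (~` E)).
exfalso.
have M2 : 0 < M ^+ 2 by rewrite exprn_gt0.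
have H U : U \in squares N n -> 1 <= Pr (Q U) E + (5 / 8 - expR K * Pr 0 E).
  move=> UK; have := accept_cost UK (measurableC mE); rewrite Pr_setC//.
  have : Pr 0 E + Pr (flat_mx A (cells U)) (~` E) < expR (- K) / 2.
    by rewrite ltNge; apply/negP => h'; apply: h; exists U.
  move=> /ltW /(ler_wpM2l (expR_ge0 K)); rewrite mulrDr mulrA -expRD subrr expR0.
  by lra.
have := reject_cost mE.
have := ler_sum (index_enum (rect N)) H.
rewrite big_split /= !sumr_const card_squares -[X in X <= _]mulr_natl.
rewrite -[X in _ <= _ + X]mulr_natl natrX mulr1.
move: (\sum_(U in _) _) (expR K * _) => S p; lra.
Qed.

Lemma minimax_risk_lower :
  ((expR (- ((d - t) ^+ 2 / 2 + 4 * Num.sqrt n%:R * d + 4 * n%:R + 3)) / 2)%:E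
   <= minimax_risk n N A)%E.
Proof.
rewrite -/s -/kappa -/K; apply: le_ereal_inf_tmp => _ [T _ <-].
have mE : measurable (T @^-1` [set true]).
  by rewrite -[X in measurable X]setTI; exact: measurable_funP.
have mEc : measurable (T @^-1` [set false]).
  by rewrite -[X in measurable X]setTI; exact: measurable_funP.
have TE : T @^-1` [set false] = ~` (T @^-1` [set true]).
  by apply/seteqP; split=> X /=; case: (T X).
have [U UK hU] := some_square_hard mE.
apply: (@le_trans _ _ (Pr 0 (T @^-1` [set true]) +
   Pr (flat_mx A (cells U)) (T @^-1` [set false]))%:E).
  by rewrite lee_fin TE.
rewrite EFinD !PrE// leeD2l//; apply: ereal_sup_ubound => /=.
exists (flat_mx A (cells U)) => //; exists U.1, U.2.
have [U1 U2] := squaresP UK; split=> // i j ij; rewrite mxE /cells; first by rewrite ij.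
by rewrite (negbTE ij).
Qed.

End lower_bound.

(** * Nonasymptotic bounds for the logarithm of the risk *)

Section risk_exponent.
Context (R : realType).

Definition log_scan (n N : nat) : R := 2 * ln 'C(N, n)%:R.

Definition risk_exponent (L d : R) : R := (d ^+ 2 / 2 - L) ^+ 2 / (2 * d ^+ 2).

Lemma ln2_le1 : ln 2 <= 1 :> R.
Proof. by rewrite -[leRHS]expRK ler_ln ?posrE ?expR_gt0// expR1_ge2. Qed.

Lemma log_scan_ge0 n N : (n <= N)%N -> 0 <= log_scan n N.
Proof. by move=> nN; rewrite mulr_ge0// ln_ge0// ler1n bin_gt0. Qed.

Lemma ln_card_scan_sets n N : (0 < n <= N)%N ->
  ln (#|scan_sets n N|%:R : R) = log_scan n N.
Proof.
move=> /andP[n0 nN]; rewrite card_scan_sets// natrX lnXn ?ltr0n ?bin_gt0//.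
by rewrite /log_scan mulr_natl.
Qed.

(** The two bounds meet at the threshold [t] with [t d = L + d^2 / 2]; the
    hypothesis [L <= d^2 / 2] says that [t <= d]. *)
Lemma log_risk_bounds n N (A : R) (d := n%:R * A) : (0 < n <= N)%N -> 0 < A ->
  log_scan n N <= d ^+ 2 / 2 ->
  - (risk_exponent (log_scan n N) d + (4 * Num.sqrt n%:R * d + 4 * n%:R + 4))
  <= ln (fine (minimax_risk n N A)) <= - risk_exponent (log_scan n N) d + 1.
Proof.
move=> /andP[n0 nN] A0 La.
have nR0 : (0 : R) < n%:R by rewrite ltr0n.
have d0 : 0 < d by exact: mulr_gt0.
have dn0 : d != 0 by rewrite gt_eqF.
have M0 : (0 : R) < 'C(N, n)%:R by rewrite ltr0n bin_gt0.
have L0 := log_scan_ge0 nN.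
set L := log_scan n N in La L0 *.
pose t := (L + d ^+ 2 / 2) / d.
have t0 : 0 <= t by rewrite divr_ge0 ?(ltW d0)// addr_ge0// divr_ge0// sqr_ge0.
have td : t <= d.
  rewrite ler_pdivrMr// -expr2; lra.
have tE : L = t * d - d ^+ 2 / 2 by rewrite /t divfK//; ring.
have kE : (d - t) ^+ 2 / 2 = risk_exponent L d.
  by rewrite /risk_exponent /t; field.
have lower := minimax_risk_lower n0 nN t0 td tE.
have upper := scan_test_risk N n0 (introT andP (conj t0 td)).
rewrite -/d kE in lower upper.
set K := _ + 3 in lower.
have upE : 'C(N, n)%:R ^+ 2 * expR (- (t ^+ 2 / 2)) + expR (- risk_exponent L d) =
    2 * expR (- risk_exponent L d).
  rewrite -kE -[X in X ^+ 2 * _]lnK ?posrE// -expRM_natl -expRD.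
  rewrite (_ : 2 * ln _ + _ = - ((d - t) ^+ 2 / 2)); last first.
    by rewrite -/(log_scan n N) -/L tE; field.
  by ring.
rewrite upE in upper.
have fin : minimax_risk n N A \is a fin_num.
  rewrite fin_numE; apply/andP; split.
    by apply: contraTneq lower => ->; rewrite leeNy_eq.
  by apply: contraTneq upper => ->; rewrite leye_eq.
rewrite -(fineK fin) lee_fin in lower; rewrite -(fineK fin) lee_fin in upper.
set r := fine _ in lower upper *.
have e0 x : 0 < expR x / 2 :> R by rewrite divr_gt0 ?expR_gt0.
have r0 : 0 < r by exact: lt_le_trans lower.
apply/andP; split.
  apply: (@le_trans _ _ (ln (expR (- K) / 2))); last by rewrite ler_ln// posrE.
  rewrite ln_div ?posrE ?expR_gt0// expRK.
  by have := ln2_le1; rewrite /K; lra.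
apply: (@le_trans _ _ (ln (2 * expR (- risk_exponent L d)))).
  by rewrite ler_ln// posrE mulr_gt0// expR_gt0.
rewrite lnM ?posrE ?expR_gt0// expRK.
by have := ln2_le1; lra.
Qed.

Lemma ln_bin_bounds n N : (0 < n <= N)%N ->
  n%:R * ln (N%:R / n%:R) <= ln ('C(N, n)%:R : R) <= n%:R * ln (N%:R / n%:R) + n%:R.
Proof.
move=> /andP[n0 nN]; have N0 : (0 < N)%N by exact: leq_trans nN.
have nR0 : (0 : R) < n%:R by rewrite ltr0n.
have NR0 : (0 : R) < N%:R by rewrite ltr0n.
have z0 : (0 : R) < N%:R / n%:R by rewrite divr_gt0.
have M0 : (0 : R) < 'C(N, n)%:R by rewrite ltr0n bin_gt0.
rewrite mulr_natl -lnXn//; apply/andP; split.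
  rewrite ler_ln ?posrE ?exprn_gt0// exprMn exprVn ler_pdivrMr ?exprn_gt0//.
  by rewrite -!natrX -natrM ler_nat expn_le_bin.
rewrite -lerBlDl -ln_div ?posrE ?exprn_gt0// -[leRHS]expRK.
rewrite ler_ln ?posrE ?expR_gt0 ?divr_gt0 ?exprn_gt0//.
have := @bin_le_expR R N n; rewrite n0 nN => /(_ isT).
by rewrite -[X in _ * X]invrK -exprVn invf_div.
Qed.

End risk_exponent.

(** * Asymptotics of the number of squares and of the error terms *)

Section asymptotics.
Context (R : realType) (alpha : R).
Hypothesis alpha_gt0 : 0 < alpha.
Local Notation N n := (matrix_size alpha n).

Lemma matrix_size_bounds n : (0 < n)%N ->
  [/\ (n <= N n)%N, (N n)%:R <= (n%:R * n%:R `^ alpha : R) &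
      n%:R * n%:R `^ alpha <= (2 * (N n)%:R : R)].
Proof.
move=> n0; have n1 : (1 : R) <= n%:R by rewrite ler1n.
have nR0 : (0 : R) < n%:R by rewrite ltr0n.
have pE : n%:R `^ (1 + alpha) = n%:R * n%:R `^ alpha :> R.
  by rewrite powRD ?powRr1 ?(ltW nR0)// (gt_eqF nR0) implybT.
have a1 : 1 <= n%:R `^ alpha :> R.
  by rewrite -[leLHS](powRr0 n%:R) ler_powR// ltW.
have p0 : 0 <= n%:R `^ (1 + alpha) :> R by exact: powR_ge0.
have nN : (n <= N n)%N.
  rewrite /matrix_size -[X in (X <= _)%N](@natrK R) le_truncn// pE.
  by rewrite ler_peMr// ltW.
split=> //; rewrite -pE; first by rewrite truncn_le.
apply: (le_trans (ltW (truncnS_gt _))); rewrite -/(matrix_size _ _).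
rewrite -natr1 mulr_natl mulr2n lerD2l ler1n.
exact: leq_trans nN.
Qed.

Lemma log_scan_approx n : (1 < n)%N ->
  `| log_scan R n (N n) - 2 * alpha * (n%:R * ln n%:R) | <= 2 * n%:R.
Proof.
move=> n1; have n0 : (0 < n)%N by exact: ltnW.
have [nN Nle Nge] := matrix_size_bounds n0.
have nR0 : (0 : R) < n%:R by rewrite ltr0n.
have NR0 : (0 : R) < (N n)%:R by rewrite ltr0n (leq_trans n0).
have z0 : (0 : R) < (N n)%:R / n%:R by rewrite divr_gt0.
have p0 : 0 < n%:R `^ alpha :> R by exact: powR_gt0.
have z1 : ln ((N n)%:R / n%:R : R) <= alpha * ln n%:R.
  rewrite -ln_powR ler_ln ?posrE// ler_pdivrMr// mulrC//.
have z2 : alpha * ln n%:R - 1 <= ln ((N n)%:R / n%:R : R).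
  have : ln (n%:R `^ alpha / 2 : R) <= ln ((N n)%:R / n%:R).
    rewrite ler_ln ?posrE ?divr_gt0// ler_pdivrMr// mulrAC ler_pdivlMr//.
    by rewrite mulrC [leRHS]mulrC.
  rewrite ln_div ?posrE// ln_powR; have := ln2_le1 R; lra.
have := @ln_bin_bounds R n (N n); rewrite n0 nN => /(_ isT) /andP[b1 b2].
have := ler_wpM2l (ltW nR0) z1; have := ler_wpM2l (ltW nR0) z2.
rewrite /log_scan ler_norml => h1 h2; apply/andP; split; lra.
Qed.

(** The slowest vanishing error term, sqrt(n) d / L at the scan level, is of
    this order; all the other ones are compared with it as well. *)
Definition log_rate (n : nat) : R := (Num.sqrt (ln n%:R))^-1.
Local Notation h := log_rate.

Lemma near_ln_ge (C : R) : \forall n \near \oo, C <= ln (n%:R : R).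
Proof.
near=> n; rewrite -[leLHS]expRK ler_ln ?posrE ?expR_gt0//.
  by near: n; exact: nbhs_infty_ger.
by apply: (@lt_le_trans _ _ (expR C)); [exact: expR_gt0|near: n; exact: nbhs_infty_ger].
Unshelve. all: by end_near. Qed.

Lemma cvg_log_rate : h n @[n --> \oo] --> (0 : R).
Proof.
apply/gtr0_cvgV0.
  near=> n; rewrite sqrtr_gt0; apply: (@lt_le_trans _ _ 1) => //.
  by near: n; exact: near_ln_ge.
apply/cvgryPge => C; near=> n.
apply: (le_trans (ler_norm C)); rewrite -sqrtr_sqr ler_wsqrtr//.
by near: n; exact: near_ln_ge.
Unshelve. all: by end_near. Qed.

Lemma inv_ln_le_log_rate (n : nat) : 1 <= ln (n%:R : R) -> (ln n%:R)^-1 <= h n.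
Proof.
move=> l1; have l0 : (0 : R) < ln n%:R by exact: lt_le_trans l1.
rewrite /log_rate lef_pV2 ?posrE ?sqrtr_gt0// -{2}[ln _]sqr_sqrtr ?(ltW l0)//.
by rewrite expr2 ler_peMr ?sqrtr_ge0// -[leLHS]sqrtr1 ler_wsqrtr.
Qed.

Lemma cvg_rate (u : nat -> R) (l C : R) :
  (\forall n \near \oo, `|u n - l| <= C * h n) -> u n @[n --> \oo] --> l.
Proof.
move=> ub; apply: (@squeeze_cvgr _ _ _ _ (fun n => l - C * h n) (fun n => l + C * h n)).
- by near=> n; rewrite -ler_distl; near: n.
- rewrite -[X in _ --> X]subr0; apply: cvgB; first exact: cvg_cst.
  by rewrite -(mulr0 C); apply: cvgMr; exact: cvg_log_rate.
- rewrite -[X in _ --> X]addr0; apply: cvgD; first exact: cvg_cst.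
  by rewrite -(mulr0 C); apply: cvgMr; exact: cvg_log_rate.
Unshelve. all: by end_near. Qed.

Local Notation L n := (log_scan R n (N n)).

Lemma cvg_log_risk (A D : nat -> R) (c C1 C2 : R) :
  (\forall n \near \oo, 0 < A n) -> (\forall n \near \oo, 0 < D n) ->
  (\forall n \near \oo, L n <= (n%:R * A n) ^+ 2 / 2) ->
  (\forall n \near \oo, Num.sqrt n%:R * (n%:R * A n) / D n <= C1 * h n) ->
  (\forall n \near \oo, n%:R / D n <= C2 * h n) ->
  risk_exponent (L n) (n%:R * A n) / D n @[n --> \oo] --> c ->
  ln (risk alpha n (A n)) / D n @[n --> \oo] --> - c.
Proof.
move=> A0 D0 LA e1 e2 kc.
pose k n := risk_exponent (L n) (n%:R * A n) / D n.
have Ch C : C * h n @[n --> \oo] --> (0 : R).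
  by rewrite -(mulr0 C); apply: cvgMr; exact: cvg_log_rate.
apply: (@squeeze_cvgr _ _ _ _ (fun n => - k n - (4 * C1 + 8 * C2) * h n)
  (fun n => - k n + C2 * h n)).
- near=> n.
  have n0 : (0 < n)%N by near: n; exact: nbhs_infty_gt.
  have [nN _ _] := matrix_size_bounds n0.
  have An : 0 < A n by near: n.
  have Dn : 0 < D n by near: n.
  have LAn : L n <= (n%:R * A n) ^+ 2 / 2 by near: n.
  have e1n : Num.sqrt n%:R * (n%:R * A n) / D n <= C1 * h n by near: n.
  have e2n : n%:R / D n <= C2 * h n by near: n.
  have n1 : (1 : R) <= n%:R by rewrite ler1n.
  have := @log_risk_bounds R n (N n) (A n); rewrite n0 nN => /(_ isT An LAn).
  rewrite -/(risk alpha n (A n)) => /andP[lo up].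
  have Di : 0 <= (D n)^-1 by rewrite invr_ge0 ltW.
  have := ler_wpM2r Di lo; have := ler_wpM2r Di up; have := ler_wpM2r Di n1.
  rewrite /k; move: e1n e2n; rewrite mul1r => *; apply/andP; split; lra.
- rewrite -[X in _ --> X]subr0; apply: cvgB; last exact: Ch.
  exact: cvgN.
- rewrite -[X in _ --> X]addr0; apply: cvgD; last exact: Ch.
  exact: cvgN.
Unshelve. all: by end_near. Qed.

End asymptotics.

(** * The three limits *)

Section limits.
Context (R : realType) (alpha delta : R).
Hypotheses (alpha_gt0 : 0 < alpha) (delta_gt0 : 0 < delta).
Local Notation N n := (matrix_size alpha n).
Local Notation L n := (log_scan R n (N n)).
Local Notation h := (@log_rate R).

Let near_log_scan :
  \forall n \near \oo, `|L n / (n%:R * ln n%:R) - 2 * alpha| <= 2 * h n.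
Proof.
near=> n.
have n1 : (1 < n)%N by near: n; exact: nbhs_infty_gt.
have nR0 : (0 : R) < n%:R by rewrite ltr0n ltnW.
have l1 : (1 : R) <= ln n%:R by near: n; exact: near_ln_ge.
have l0 : (0 : R) < ln n%:R by exact: lt_le_trans l1.
have nl0 : (0 : R) < n%:R * ln n%:R by rewrite mulr_gt0.
have -> : L n / (n%:R * ln n%:R) - 2 * alpha =
    (L n - 2 * alpha * (n%:R * ln n%:R)) / (n%:R * ln n%:R).
  by field; rewrite !gt_eqF.
rewrite normrM [X in _ * X]ger0_norm ?invr_ge0 ?(ltW nl0)// ler_pdivrMr//.
apply: (le_trans (log_scan_approx alpha_gt0 n1)).
have -> : 2 * n%:R = 2 * (ln n%:R)^-1 * (n%:R * ln n%:R) :> R by field; rewrite gt_eqF.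
by rewrite ler_wpM2r ?(ltW nl0)// ler_pM2l// inv_ln_le_log_rate.
Unshelve. all: by end_near. Qed.

Let log_scan_cvg : L n / (n%:R * ln n%:R) @[n --> \oo] --> 2 * alpha.
Proof. exact: cvg_rate near_log_scan. Qed.

Let near_log_scan_ge : \forall n \near \oo, alpha * (n%:R * ln n%:R) <= L n.
Proof.
near=> n.
have n1 : (1 < n)%N by near: n; exact: nbhs_infty_gt.
have nR0 : (0 : R) < n%:R by rewrite ltr0n ltnW.
have l1 : 2 / alpha <= ln (n%:R : R) by near: n; exact: near_ln_ge.
have := log_scan_approx alpha_gt0 n1; rewrite ler_norml => /andP[+ _].
move: l1; rewrite ler_pdivrMr// => /(ler_wpM2l (ltW nR0)); lra.
Unshelve. all: by end_near. Qed.

Let near_log_scan_le (C : R) : 2 * alpha < C ->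
  \forall n \near \oo, L n <= C * (n%:R * ln n%:R).
Proof.
move=> aC; near=> n.
have n1 : (1 < n)%N by near: n; exact: nbhs_infty_gt.
have nR0 : (0 : R) < n%:R by rewrite ltr0n ltnW.
have l1 : 2 / (C - 2 * alpha) <= ln (n%:R : R) by near: n; exact: near_ln_ge.
have := log_scan_approx alpha_gt0 n1; rewrite ler_norml => /andP[_].
by move: l1; rewrite ler_pdivrMr ?subr_gt0// => /(ler_wpM2l (ltW nR0)); lra.
Unshelve. all: by end_near. Qed.

Let c := 4 * (1 + delta) * alpha.
Let c_gt0 : 0 < c. Proof. by rewrite !mulr_gt0// addr_gt0. Qed.

Let signal_sq n : (0 < n)%N -> 0 <= ln (n%:R : R) ->
  (n%:R * Ascan delta alpha n) ^+ 2 = c * (n%:R * ln n%:R).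
Proof.
move=> n0 l0; have nR0 : (n%:R : R) != 0 by rewrite pnatr_eq0 -lt0n.
rewrite exprMn sqr_sqrtr -/c; first by field.
by rewrite divr_ge0// mulr_ge0// ltW.
Qed.

(** Dividing by [n ln n], the exponent becomes a rational function of
    [L / (n ln n)], which tends to [2 alpha]. *)
Lemma cvg_log_risk_Ascan :
  ln (risk alpha n (Ascan delta alpha n)) / ln (#|scan_sets n (N n)|%:R : R)
    @[n --> \oo] --> - (delta ^+ 2 / (4 * (1 + delta))).
Proof.
apply: (@cvg_trans _ (ln (risk alpha n (Ascan delta alpha n)) / L n @[n --> \oo])).
  apply: near_eq_cvg; near=> n; rewrite ln_card_scan_sets//.
  have n0 : (0 < n)%N by near: n; exact: nbhs_infty_gt.
  by rewrite n0; have [] := matrix_size_bounds alpha_gt0 n0.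
apply: (@cvg_log_risk _ _ alpha_gt0 _ _ _ (Num.sqrt c / alpha) alpha^-1).
- near=> n.
  have n0 : (0 < n)%N by near: n; exact: nbhs_infty_gt.
  have l1 : (1 : R) <= ln n%:R by near: n; exact: near_ln_ge.
  rewrite sqrtr_gt0 divr_gt0 ?ltr0n// mulr_gt0//; exact: lt_le_trans l1.
- near=> n.
  have n0 : (0 < n)%N by near: n; exact: nbhs_infty_gt.
  have l1 : (1 : R) <= ln n%:R by near: n; exact: near_ln_ge.
  apply: (@lt_le_trans _ _ (alpha * (n%:R * ln n%:R))).
    by rewrite !mulr_gt0 ?ltr0n//; exact: lt_le_trans l1.
  by near: n.
- near=> n.
  have n0 : (0 < n)%N by near: n; exact: nbhs_infty_gt.
  have l1 : (1 : R) <= ln n%:R by near: n; exact: near_ln_ge.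
  rewrite signal_sq//; last exact: le_trans l1.
  have -> : c * (n%:R * ln n%:R) / 2 = c / 2 * (n%:R * ln n%:R) by field.
  near: n; apply: near_log_scan_le; rewrite /c; have := mulr_gt0 alpha_gt0 delta_gt0; lra.
- near=> n.
  have n0 : (0 < n)%N by near: n; exact: nbhs_infty_gt.
  have nR0 : (0 : R) < n%:R by rewrite ltr0n.
  have l1 : (1 : R) <= ln n%:R by near: n; exact: near_ln_ge.
  have l0 : (0 : R) < ln n%:R by exact: lt_le_trans l1.
  have Lge : alpha * (n%:R * ln n%:R) <= L n by near: n.
  have nl0 : 0 < alpha * (n%:R * ln n%:R) by rewrite !mulr_gt0.
  have dE : Num.sqrt n%:R * (n%:R * Ascan delta alpha n) =
      n%:R * Num.sqrt c * Num.sqrt (ln n%:R).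
    rewrite -[X in _ * X = _]ger0_norm; last by rewrite mulr_ge0// sqrtr_ge0.
    rewrite -sqrtr_sqr signal_sq ?(ltW l0)// (sqrtrM _ (ltW c_gt0)) (sqrtrM _ (ler0n R n)).
    rewrite (_ : _ * (_ * _) = Num.sqrt n%:R ^+ 2 * Num.sqrt c * Num.sqrt (ln n%:R)).
      by rewrite sqr_sqrtr ?ler0n.
    by ring.
  have s0 : 0 < Num.sqrt (ln n%:R : R) by rewrite sqrtr_gt0.
  apply: (@le_trans _ _ (n%:R * Num.sqrt c * Num.sqrt (ln n%:R) / (alpha * (n%:R * ln n%:R)))).
    by rewrite dE ler_wpM2l ?mulr_ge0 ?sqrtr_ge0// lef_pV2 ?posrE// (lt_le_trans nl0).
  rewrite /log_rate -{2}[ln _]sqr_sqrtr ?(ltW l0)//.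
  rewrite le_eqVlt; apply/orP; left; apply/eqP; field.
  by rewrite !gt_eqF.
- near=> n.
  have n0 : (0 < n)%N by near: n; exact: nbhs_infty_gt.
  have nR0 : (0 : R) < n%:R by rewrite ltr0n.
  have l1 : (1 : R) <= ln n%:R by near: n; exact: near_ln_ge.
  have l0 : (0 : R) < ln n%:R by exact: lt_le_trans l1.
  have Lge : alpha * (n%:R * ln n%:R) <= L n by near: n.
  have nl0 : 0 < alpha * (n%:R * ln n%:R) by rewrite !mulr_gt0.
  apply: (@le_trans _ _ (n%:R / (alpha * (n%:R * ln n%:R)))).
    by rewrite ler_wpM2l ?ler0n// lef_pV2 ?posrE// (lt_le_trans nl0).
  have -> : n%:R / (alpha * (n%:R * ln n%:R)) = alpha^-1 * (ln n%:R)^-1.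
    by field; rewrite !gt_eqF.
  by rewrite ler_wpM2l ?invr_ge0 ?(ltW alpha_gt0)// inv_ln_le_log_rate.
- apply: (@cvg_trans _ ((c / 2 - L n / (n%:R * ln n%:R)) ^+ 2 /
      (2 * c * (L n / (n%:R * ln n%:R))) @[n --> \oo])).
    apply: near_eq_cvg; near=> n.
    have n0 : (0 < n)%N by near: n; exact: nbhs_infty_gt.
    have nR0 : (0 : R) < n%:R by rewrite ltr0n.
    have l1 : (1 : R) <= ln n%:R by near: n; exact: near_ln_ge.
    have l0 : (0 : R) < ln n%:R by exact: lt_le_trans l1.
    have Lge : alpha * (n%:R * ln n%:R) <= L n by near: n.
    have L0 : 0 < L n by apply: lt_le_trans Lge; rewrite !mulr_gt0.
    rewrite /risk_exponent signal_sq ?(ltW l0)//; field.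
    by rewrite !gt_eqF.
  have -> : delta ^+ 2 / (4 * (1 + delta)) =
      (c / 2 - 2 * alpha) ^+ 2 / (2 * c * (2 * alpha)).
    by rewrite /c; field; rewrite !gt_eqF// addr_gt0.
  apply: cvgM.
    under eq_fun do rewrite expr2; rewrite expr2.
    by apply: cvgM; apply: cvgB; (exact: cvg_cst || exact: log_scan_cvg).
  apply: cvgV; first by rewrite gt_eqF// !mulr_gt0// addr_gt0.
  exact: cvgMr.
Unshelve. all: by end_near. Qed.

Section large_signal.
Hypothesis sum_gt : 1 / 2 < alpha + delta.
Let eps := alpha + delta - 1 / 2.
Let eps_gt0 : 0 < eps. Proof. by rewrite subr_gt0. Qed.
(** [E n] is n^(alpha + delta - 1/2), the ratio of d = n^(alpha + delta) to
    sqrt n; it grows faster than any power of [ln n]. *)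
Let E n : R := expR (eps * ln n%:R).

Let E_ge n : 0 < (n%:R : R) -> eps * ln n%:R <= E n.
Proof. by move=> n0; have := expR_ge1Dx (eps * ln n%:R); rewrite -/(E n); lra. Qed.

Let sqrtE n : 0 < (n%:R : R) -> Num.sqrt n%:R = expR (ln n%:R / 2) :> R.
Proof.
move=> n0; rewrite -{1}[n%:R]lnK// -[RHS]ger0_norm ?expR_ge0// -sqrtr_sqr.
by rewrite -expRM_natl; congr (Num.sqrt (expR _)); field.
Qed.

Let signalE n : 0 < (n%:R : R) ->
  n%:R * n%:R `^ (- (1 - alpha - delta)) = Num.sqrt n%:R * E n :> R.
Proof.
move=> n0; rewrite sqrtE// /powR gt_eqF// -{1}[n%:R]lnK// -!expRD.
by congr expR; rewrite /eps; field.
Qed.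

Let normE n : 0 < (n%:R : R) -> n%:R `^ (2 * (alpha + delta)) = n%:R * E n ^+ 2 :> R.
Proof.
move=> n0; rewrite /powR gt_eqF// -[X in _ = X * _]lnK// -expRM_natl -expRD.
by congr expR; rewrite /eps; field.
Qed.

Lemma near_Ascan_le : \forall n \near \oo,
  Ascan delta alpha n <= n%:R `^ (- (1 - alpha - delta)).
Proof.
near=> n.
have n0 : (0 < n)%N by near: n; exact: nbhs_infty_gt.
have nR0 : (0 : R) < n%:R by rewrite ltr0n.
have l1 : (1 : R) <= ln n%:R by near: n; exact: near_ln_ge.
have l2 : c / eps ^+ 2 <= ln (n%:R : R) by near: n; exact: near_ln_ge.
have l0 : (0 : R) < ln n%:R by exact: lt_le_trans l1.
rewrite -(ler_pM2l nR0) signalE// -ler_sqr ?nnegrE; last 2 first.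
- by rewrite mulr_ge0// sqrtr_ge0.
- by rewrite mulr_ge0 ?sqrtr_ge0// expR_ge0.
rewrite signal_sq ?(ltW l0)// exprMn sqr_sqrtr ?ler0n// mulrCA ler_pM2l//.
have Eg := E_ge nR0.
apply: (@le_trans _ _ ((eps * ln n%:R) ^+ 2)).
  rewrite exprMn expr2 mulrA ler_pM2r// -expr2 mulrC.
  by move: l2; rewrite ler_pdivrMr ?exprn_gt0.
by rewrite lerXn2r ?nnegrE ?expR_ge0// mulr_ge0 ?(ltW eps_gt0)// ltW.
Unshelve. all: by end_near. Qed.

(** Here [d^2] is the normalization itself and [L / d^2] tends to 0, so that the
    exponent over [d^2] is [(1 / 2 - L / d^2)^2 / 2]. *)
Lemma cvg_log_risk_power :
  ln (risk alpha n (n%:R `^ (- (1 - alpha - delta)))) / n%:R `^ (2 * (alpha + delta))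
    @[n --> \oo] --> - (1 / 8 : R).
Proof.
pose C := (2 * alpha + 1) / eps ^+ 2.
have LD : \forall n \near \oo, 0 <= L n / n%:R `^ (2 * (alpha + delta)) <= C / ln n%:R.
  near=> n.
  have n0 : (0 < n)%N by near: n; exact: nbhs_infty_gt.
  have nR0 : (0 : R) < n%:R by rewrite ltr0n.
  have l1 : (1 : R) <= ln n%:R by near: n; exact: near_ln_ge.
  have l0 : (0 : R) < ln n%:R by exact: lt_le_trans l1.
  have Lle : L n <= (2 * alpha + 1) * (n%:R * ln n%:R).
    by near: n; apply: near_log_scan_le; rewrite ltrDl.
  have [nN _ _] := matrix_size_bounds alpha_gt0 n0.
  rewrite divr_ge0 ?log_scan_ge0 ?powR_ge0//= normE//.
  have Eg := E_ge nR0.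
  have el0 : 0 < eps * ln n%:R by rewrite mulr_gt0.
  have nE0 : 0 < n%:R * E n ^+ 2 by rewrite mulr_gt0// exprn_gt0// expR_gt0.
  rewrite ler_pdivrMr//; apply: (le_trans Lle).
  have -> : (2 * alpha + 1) * (n%:R * ln n%:R) =
      C / ln n%:R * (n%:R * (eps * ln n%:R) ^+ 2).
    by rewrite /C; field; rewrite !gt_eqF.
  rewrite ler_wpM2l ?ler_wpM2l ?ler0n//.
    by rewrite !divr_ge0 ?exprn_ge0 ?(ltW eps_gt0) ?(ltW l0)// addr_ge0// mulr_ge0// ltW.
  by rewrite lerXn2r ?nnegrE ?expR_ge0// ltW.
apply: (@cvg_log_risk _ _ alpha_gt0 _ _ _ eps^-1 (eps ^+ 2)^-1).
- by near=> n; rewrite powR_gt0// ltr0n; near: n; exact: nbhs_infty_gt.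
- by near=> n; rewrite powR_gt0// ltr0n; near: n; exact: nbhs_infty_gt.
- near=> n.
  have n0 : (0 < n)%N by near: n; exact: nbhs_infty_gt.
  have nR0 : (0 : R) < n%:R by rewrite ltr0n.
  have l1 : 2 * C + 1 <= ln (n%:R : R) by near: n; exact: near_ln_ge.
  have C0 : 0 <= C by rewrite divr_ge0 ?exprn_ge0 ?(ltW eps_gt0)// addr_ge0// mulr_ge0// ltW.
  have l0 : (0 : R) < ln n%:R by lra.
  have D0 : 0 < n%:R `^ (2 * (alpha + delta)) :> R by rewrite powR_gt0.
  have : 0 <= L n / n%:R `^ (2 * (alpha + delta)) <= C / ln n%:R by near: n.
  move=> /andP[_]; rewrite signalE// exprMn sqr_sqrtr ?ler0n// -normE//.
  rewrite ler_pdivrMr// => /le_trans; apply; rewrite mulrC ler_wpM2l ?(ltW D0)//.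
  by rewrite ler_pdivrMr//; lra.
- near=> n.
  have n0 : (0 < n)%N by near: n; exact: nbhs_infty_gt.
  have nR0 : (0 : R) < n%:R by rewrite ltr0n.
  have l1 : (1 : R) <= ln n%:R by near: n; exact: near_ln_ge.
  have l0 : (0 : R) < ln n%:R by exact: lt_le_trans l1.
  have E0 : 0 < E n by exact: expR_gt0.
  rewrite signalE// normE// mulrA -expr2 sqr_sqrtr ?ler0n//.
  have -> : n%:R * E n / (n%:R * E n ^+ 2) = (E n)^-1 by field; rewrite !gt_eqF.
  apply: (@le_trans _ _ (eps^-1 * (ln n%:R)^-1)).
    by rewrite -invfM lef_pV2 ?posrE ?mulr_gt0// E_ge.
  by rewrite ler_wpM2l ?invr_ge0 ?(ltW eps_gt0)// inv_ln_le_log_rate.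
- near=> n.
  have n0 : (0 < n)%N by near: n; exact: nbhs_infty_gt.
  have nR0 : (0 : R) < n%:R by rewrite ltr0n.
  have l1 : (1 : R) <= ln n%:R by near: n; exact: near_ln_ge.
  have l0 : (0 : R) < ln n%:R by exact: lt_le_trans l1.
  have E0 : 0 < E n by exact: expR_gt0.
  rewrite normE//.
  have -> : n%:R / (n%:R * E n ^+ 2) = (E n ^+ 2)^-1 by field; rewrite !gt_eqF.
  apply: (@le_trans _ _ ((eps ^+ 2)^-1 * (ln n%:R)^-1)); last first.
    by rewrite ler_wpM2l ?invr_ge0 ?exprn_ge0 ?(ltW eps_gt0)// inv_ln_le_log_rate.
  rewrite -invfM lef_pV2 ?posrE ?mulr_gt0 ?exprn_gt0//.
  apply: (@le_trans _ _ ((eps * ln n%:R) ^+ 2)).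
    by rewrite exprMn ler_pM2l ?exprn_gt0// expr2 ler_peMr// ltW.
  by rewrite lerXn2r ?nnegrE ?expR_ge0 ?E_ge// mulr_ge0 ?(ltW eps_gt0)// ltW.
- apply: (@cvg_trans _ ((1 / 2 - L n / n%:R `^ (2 * (alpha + delta))) ^+ 2 / 2 @[n --> \oo])).
    apply: near_eq_cvg; near=> n.
    have n0 : (0 < n)%N by near: n; exact: nbhs_infty_gt.
    have nR0 : (0 : R) < n%:R by rewrite ltr0n.
    have D0 : 0 < n%:R `^ (2 * (alpha + delta)) :> R by rewrite powR_gt0.
    rewrite /risk_exponent signalE// exprMn sqr_sqrtr ?ler0n// -normE//.
    by field; rewrite gt_eqF.
  have L0 : L n / n%:R `^ (2 * (alpha + delta)) @[n --> \oo] --> (0 : R).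
    apply: (@cvg_rate _ _ _ C); near=> n.
    have /andP[q0 q1] : 0 <= L n / n%:R `^ (2 * (alpha + delta)) <= C / ln n%:R by near: n.
    have C0 : 0 <= C by rewrite divr_ge0 ?exprn_ge0 ?(ltW eps_gt0)// addr_ge0// mulr_ge0// ltW.
    have l1 : (1 : R) <= ln n%:R by near: n; exact: near_ln_ge.
    have l0 : (0 : R) < ln n%:R by exact: lt_le_trans l1.
    rewrite subr0 ger0_norm//; apply: (le_trans q1).
    by rewrite ler_wpM2l// inv_ln_le_log_rate.
  have -> : 1 / 8 = (1 / 2 - 0) ^+ 2 / 2 :> R by field.
  apply: cvgM; last exact: cvg_cst.
  under eq_fun do rewrite expr2; rewrite expr2.
  by apply: cvgM; apply: cvgB; (exact: cvg_cst || exact: L0).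
Unshelve. all: by end_near. Qed.

End large_signal.

End limits.

Theorem theorem2p2 (R : realType) (alpha delta : R)
    (alpha_gt0 : 0 < alpha) (delta_gt0 : 0 < delta) :
  [/\ 1 / 2 < alpha + delta ->
      ln (risk alpha n (Astar delta alpha n)) /
        ln (#|scan_sets n (matrix_size alpha n)|%:R : R)
        @[n --> \oo] --> - (delta ^+ 2 / (4 * (1 + delta))),
      ln (risk alpha n (Num.sqrt (4 * (1 + delta) * alpha * ln n%:R / n%:R))) /
        ln (#|scan_sets n (matrix_size alpha n)|%:R : R)
        @[n --> \oo] --> - (delta ^+ 2 / (4 * (1 + delta)))
    & 1 / 2 < alpha + delta -> alpha <= 1 / 2 ->
      ln (risk alpha n (AstarBI delta alpha n)) / n%:R `^ (2 * (alpha + delta))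
        @[n --> \oo] --> (- (1 / 8) : R)].
Proof.
split=> [sum_gt||sum_gt alpha_le].
- apply: cvg_trans (cvg_log_risk_Ascan alpha_gt0 delta_gt0).
  apply: near_eq_cvg; near=> n.
  have -> : Astar delta alpha n = Ascan delta alpha n.
    apply/min_idPr; near: n; exact: near_Ascan_le.
  by [].
- exact: cvg_log_risk_Ascan.
- rewrite /AstarBI alpha_le; exact: cvg_log_risk_power.
Unshelve. all: by end_near. Qed.
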